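(* Let $d>0$ and let $\vec e=(e_1,e_2,e_3,e_4)$ be integers with $2d-2=\sum_{i=1}^4(e_i-1)$ and $2\le e_1\le e_2\le e_3\le e_4\le d$. Then the Hurwitz number $h(d,4,0,\vec e)$ is equal to $\min\{e_i(d+1-e_i)\}_{1\le i\le 4}$. Moreover, the possible Hurwitz factorizations $(\sigma_1,\sigma_2,\sigma_3,\sigma_4)$ for $(d,4,0,\vec e)$ are classified explicitly up to equivalence as follows: every tuple listed below is a Hurwitz factorization of the stated type (i) or (ii), and every Hurwitz factorization is equivalent to exactly one of those listed. (i) If $\sigma_3\sigma_4$ is trivial or a single cycle, then $$\sigma_1=\bigl(d,d-1,\dots,e_3+e_4+1-k,\ \sigma^{-(d+2-k-e_1)}(\ell),\sigma^{-(d+3-k-e_1)}(\ell),\dots,\sigma^{-(e_3+e_4+1-2k)}(\ell)=\ell\bigr),$$ $$\sigma_2=\bigl(e_3+e_4+1-k,e_3+e_4+2-k,\dots,d-1,d,\ \ell,\sigma^{-1}(\ell),\dots,\sigma^{-(d+1-k-e_1)}(\ell)\bigr),$$ $$\sigma_3=\bigl(k,k-1,\dots,2,1,\ e_4+1,e_4+2,\dots,e_3+e_4-k\bigr),$$ $$\sigma_4=(1,\dots,e_4),$$ where $k$ is any integer with $e_3+e_4-d\le k\le e_3$ and $k\le d+1-e_2$, where $\sigma:=(k,k+1,\dots,e_3+e_4-k)=\sigma_3\sigma_4$, and where, for a given $k$, $\ell$ is any integer with $k\le \ell\le e_3+e_4-k$. (ii) If $\sigma_3\sigma_4$ is a product of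 two disjoint cycles, then $$\sigma_1=(m+e_1-1,m+e_1-2,\dots,m+1,m),$$ $$\sigma_2=\bigl(d,d-1,\dots,m+e_1,\ m+d+k-e_3-e_4,m+d-1+k-e_3-e_4,\dots,k\bigr),$$ $$\sigma_3=\bigl(k,k-1,\dots,1,\ e_4+1,e_4+2,\dots,m+e_1-1,\ m,m-1,\dots,m+d+1+k-e_3-e_4,\ m+e_1,m+e_1+1,\dots,d\bigr),$$ $$\sigma_4=(1,\dots,e_4),$$ where $k$ is any integer with $1\le k\le e_3+e_4-d-1$, and $m$ is any integer with $e_4-e_1+1\le m\le d+1-e_1$ and $m\le e_4$.
   Context: A Hurwitz factorization for $(d,4,0,\vec e)$ is a tuple $(\sigma_1,\sigma_2,\sigma_3,\sigma_4)$ of elements of $S_d$ such that $\sigma_i$ is an $e_i$-cycle for each $i$, $\sigma_1\sigma_2\sigma_3\sigma_4=1$, and the $\sigma_i$ generate a transitive subgroup of $S_d$. Two Hurwitz factorizations are equivalent if they are related by simultaneous conjugation by an element of $S_d$. The Hurwitz number $h(d,4,0,\vec e)$ is the number of equivalence classes of Hurwitz factorizations. Conventions: products of permutations are composed right to left (as functions), and $(a_1,a_2,\dots,a_n)$ denotes the cycle $a_1\mapsto a_2\mapsto\dots\mapsto a_n\mapsto a_1$. In the cycle notation, a run $i,i+1,\dots,j$ denotes the ascending sequence of length $j-i+1$ if $j\ge i$, and the case $j=i-1$ is allowed and means the empty sequence (of length $0$); similarly for descending sequences and for the sequences of powers of $\sigma$ applied to $\ell$ (indexed by the exponents). If $k=e_3+e_4-k$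 then $\sigma=(k)$ is the identity. *)

(* Defs.v *)
From mathcomp Require Export all_boot all_fingroup.

Set Implicit Arguments.
Unset Strict Implicit.
Unset Printing Implicit Defensive.

Import GroupScope.

(* MathComp's [s * t] applies [s] first; [permc] composes right to left. *)
Definition permc (T : finType) (s t : {perm T}) : {perm T} := t * s.

(* The cycle a_1 -> a_2 -> ... -> a_n -> a_1 for s = [:: a_1; ...; a_n];
   [undup] only serves to make this total, it is the identity on duplicate-free
   sequences. *)
Definition cycp (T : finType) (s : seq T) : {perm T} :=
  perm (can_inj (prev_next (undup_uniq s))).

Definition is_cycle (T : finType) (n : nat) (s : {perm T}) : bool :=
  [exists c : n.-tuple T, uniq c && (s == cycp c)].

Definition trivial_or_cycle (T : finType) (s : {perm T}) : Prop :=
  s = 1 \/ exists2 n, 1 < n & is_cycle n s.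

Definition two_disjoint_cycles (T : finType) (s : {perm T}) : Prop :=
  exists c1 c2 : seq T,
    [/\ 1 < size c1, 1 < size c2, uniq (c1 ++ c2) & s = permc (cycp c1) (cycp c2)].

(* The genus does not occur: it is determined by d and e through the
   Riemann-Hurwitz formula. *)
Definition hurwitz_factorization (d r : nat) (e : r.-tuple nat)
    (t : r.-tuple 'S_d) : bool :=
  [&& [forall i, is_cycle (tnth e i) (tnth t i)],
      foldr (@permc _) 1 t == 1
    & [transitive <<[set s in t]>>, on [set: 'I_d] | 'P]].

Definition hurwitz_equiv (d r : nat) : rel (r.-tuple 'S_d) :=
  fun t u => [exists g : 'S_d, [forall i, tnth u i == tnth t i ^ g]].

Definition hurwitz_number (d r : nat) (e : r.-tuple nat) : nat :=
  #|equivalence_partition (@hurwitz_equiv d r)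
      [set t : r.-tuple 'S_d | hurwitz_factorization e t]|.

(* asc i j = i, i+1, ..., j and desc j i = j, j-1, ..., i; both are empty when
   j = i - 1. *)
Definition asc (i j : nat) : seq nat := index_iota i j.+1.
Definition desc (j i : nat) : seq nat := rev (asc i j).

(* The set {1, ..., d} is represented by 'I_d, the integer a being the ordinal
   of value a - 1; integers outside {1, ..., d} get a default value. *)
Definition pt (d : nat) (d_gt0 : 0 < d) (a : nat) : 'I_d :=
  insubd (Ordinal d_gt0) a.-1.

Section Representatives.

Variables (d : nat) (d_gt0 : 0 < d) (e1 e2 e3 e4 : nat).

Local Notation pts := (map (pt d_gt0)).

Definition sigma (k : nat) : 'S_d := cycp (pts (asc k (e3 + e4 - k))).

(* sigma^{-i}(l), sigma^{-(i+1)}(l), ..., sigma^{-j}(l) *)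
Definition powers (k l i j : nat) : seq 'I_d :=
  [seq (sigma k ^- a) (pt d_gt0 l) | a <- asc i j].

Definition admissible1 (k l : nat) : Prop :=
  [/\ e3 + e4 - d <= k <= e3, k <= d + 1 - e2 & k <= l <= e3 + e4 - k].

Definition factorization1 (k l : nat) : 4.-tuple 'S_d :=
  [tuple
    cycp (pts (desc d (e3 + e4 + 1 - k))
          ++ powers k l (d + 2 - k - e1) (e3 + e4 + 1 - 2 * k));
    cycp (pts (asc (e3 + e4 + 1 - k) d) ++ powers k l 0 (d + 1 - k - e1));
    cycp (pts (desc k 1 ++ asc (e4 + 1) (e3 + e4 - k)));
    cycp (pts (asc 1 e4))].

Definition admissible2 (k m : nat) : Prop :=
  [/\ 1 <= k <= e3 + e4 - d - 1, e4 - e1 + 1 <= m <= d + 1 - e1 & m <= e4].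

Definition factorization2 (k m : nat) : 4.-tuple 'S_d :=
  [tuple
    cycp (pts (desc (m + e1 - 1) m));
    cycp (pts (desc d (m + e1) ++ desc (m + d + k - e3 - e4) k));
    cycp (pts (desc k 1 ++ asc (e4 + 1) (m + e1 - 1)
               ++ desc m (m + d + 1 + k - e3 - e4) ++ asc (m + e1) d));
    cycp (pts (asc 1 e4))].

End Representatives.

(* The list as an indexed family, the index being a kind together with a pair
   of parameters: (k, l) for the first kind, (k, m) for the second. *)
Inductive entry : Type := First of nat & nat | Second of nat & nat.

Definition admissible (d e1 e2 e3 e4 : nat) (i : entry) : Prop :=
  match i with
  | First k l => admissible1 d e2 e3 e4 k l
  | Second k m => admissible2 d e1 e3 e4 k m
  end.

Definition factorization (d : nat) (d_gt0 : 0 < d) (e1 e3 e4 : nat)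
    (i : entry) : 4.-tuple 'S_d :=
  match i with
  | First k l => factorization1 d_gt0 e1 e3 e4 k l
  | Second k m => factorization2 d_gt0 e1 e3 e4 k m
  end.

Definition sigma34 (d : nat) (t : 4.-tuple 'S_d) : 'S_d :=
  permc (tnth t (inord 2)) (tnth t (inord 3)).

(* Main.v *)
(* Compose from left to right, so that s4 s3 s2 s1 = 1, and put tau = s4 s3.
   Since (a, X, Y) = (a, X)(a, Y), two cycles whose supports meet in a block run
   in opposite directions satisfy (V, a, X)(a, V^-1, W) = (a, X, W).
   Conversely a point common to the supports of s4 and s3 and fixed by tau is
   one where s3 undoes s4; if only one common point a is moved by tau, the
   common points therefore form a single block, and s4 and s3 have the shape
   above.  If two common points are moved, there are two blocks.
   When the supports of s1 and s2 meet, counting the points of the two unions of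
   supports, together with 2d + 2 = e1 + e2 + e3 + e4, leaves room for only one
   moved point in each overlap: this gives (i), up to relabelling the points in
   the order V, a, X, W, U.  When they are disjoint, tau = s1^-1 s2^-1 has
   exactly two moved points in the overlap of s3 and s4: this gives (ii).
   The parameters k, l, m are read off from the overlaps of the supports, hence
   are invariant under conjugation, and the number of admissible parameters is
   an arithmetic sum. *)
Require Import Defs.
From mathcomp Require Import zify.

Set Implicit Arguments.
Unset Strict Implicit.
Unset Printing Implicit Defensive.

(** * Cycles *)

(** Conjugation relabels the letters of a word, so a class of tuples is known once its four cycles
    are written over common blocks of distinct letters. Only the block lengths and the place of [l]
    then matter, and the bounds on [k] and [m] say that these lengths are nonnegative.

    Type (i) uses the overlap identity twice. Since [s2 s1] is the inverse of [tau], the word of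
    [tau] is cut at [a] by the pair [s4], [s3], and its reversal is cut at [l] by the pair [s2],
    [s1]; the place of [l] relative to [a] is free. The obstacle is [tau = 1], where no point is
    moved: the pivot is then the single point common to the two unions of supports, and
    [a :: X ++ W] and [l :: B ++ C] have one letter.

    In type (ii) the sizes of the pairwise overlaps of supports depend on [m] alone: [s3] and [s4]
    always share [e3 + e4 - d] points, and [k] only tells how the cancelled ones are divided between
    [V] and [U]. Recovering [k] therefore needs the order of the points along [s4], not just
    sizes. *)

Section Cycles.

Local Open Scope group_scope.

Variable T : finType.
Implicit Types (s X Y V W U Z : seq T) (a b x y : T) (f g : {perm T}).

Lemma cycpE s x : uniq s -> cycp s x = next s x.
Proof. by move=> us; rewrite permE undup_id. Qed.

Lemma cycp_notin s x : x \notin s -> cycp s x = x.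
Proof. by move=> xs; rewrite permE next_nth mem_undup (negbTE xs). Qed.

Lemma mem_cycp s x : (cycp s x \in s) = (x \in s).
Proof. by rewrite permE -[in LHS]mem_undup mem_next mem_undup. Qed.

Lemma cycpJ s g : cycp s ^ g = cycp (map g s).
Proof.
apply/permP=> x; rewrite -[x](permKV g) permJ !permE.
by rewrite undup_map_inj ?next_map ?undup_uniq //; apply: perm_inj.
Qed.

Lemma cycp_rot n s : uniq s -> cycp (rot n s) = cycp s.
Proof. by move=> us; apply/permP=> x; rewrite !cycpE ?rot_uniq ?next_rot. Qed.

Lemma cycp_catC s1 s2 : uniq (s1 ++ s2) -> cycp (s2 ++ s1) = cycp (s1 ++ s2).
Proof. by move=> us; rewrite -[in RHS](cycp_rot (size s1)) ?rot_size_cat. Qed.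

Lemma cycp_rev s : uniq s -> cycp (rev s) = (cycp s)^-1.
Proof.
move=> us; apply/permP=> x; apply: (@perm_inj _ (cycp s)).
by rewrite permKV !cycpE ?rev_uniq // next_rev // next_prev.
Qed.

(** Transpositions through a common point [a] make a cut of the word at [a] into a cut of a product;
    [cycp_mul] is then a splitting of the product. *)
Lemma cycp_cons_tperm a X :
  uniq (a :: X) -> cycp (a :: X) = \prod_(x <- X) tperm a x.
Proof.
elim/last_ind: X => [|X y IH] us.
  rewrite big_nil; apply/permP=> x; rewrite perm1 cycpE // next_nth.
  by case: ifP => //; rewrite inE => /eqP ->; rewrite /= eqxx.
have [ya us'] : a != y /\ uniq (a :: X).
  move: us; rewrite -rcons_cons rcons_uniq inE negb_or eq_sym.
  by case/andP=> /andP[].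
have yX : y \notin a :: X by move: us; rewrite -rcons_cons rcons_uniq => /andP[].
rewrite big_rcons /= -{}IH //; apply/permP=> z; rewrite permM !cycpE //.
rewrite !next_nth -rcons_cons mem_rcons inE.
have [->|zy] /= := eqVneq z y.
  rewrite (negbTE yX) tpermR /= (negbTE ya) nth_rcons.
  have -> : index y (rcons X y) = size X.
    move: yX; rewrite -cats1 index_cat inE negb_or /= => /andP[_ /negbTE->].
    by rewrite eqxx addn0.
  by rewrite ltnNge leqnSn /= gtn_eqF.
case: ifPn => zaX; last first.
  by rewrite tpermD // eq_sym //; move: zaX; rewrite inE negb_or => /andP[].
have -> : (if a == z then 0 else (index z (rcons X y)).+1) = index z (a :: X).
  move: zaX; rewrite /= inE eq_sym; case: eqP => //= _ zX.
  by rewrite -cats1 index_cat zX.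
rewrite -[if a == z then _ else _]/(index z (a :: X)) nth_rcons.
set i := index _ _; have : i <= size X by rewrite -ltnS -index_mem in zaX *.
(* For the last letter of [a :: X], [next] wraps around to [a], which the new transposition sends on
   to [y]. *)
rewrite leq_eqVlt => /orP[/eqP->|lt]; first by rewrite ltnn eqxx nth_default ?tpermL.
rewrite lt tpermD //.
  by apply/eqP=> e; move: us'; rewrite /= e mem_nth.
by apply/eqP=> e; move: yX; rewrite e inE mem_nth ?orbT.
Qed.

Lemma cycp_mul a X Y :
  uniq (a :: X ++ Y) -> cycp (a :: X) * cycp (a :: Y) = cycp (a :: X ++ Y).
Proof.
move=> us; rewrite !cycp_cons_tperm ?big_cat //.
  by move: us; rewrite /= mem_cat negb_or cat_uniq => /and4P[/andP[_ ->] _ _ ->].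
by move: us; rewrite /= mem_cat negb_or cat_uniq => /and4P[/andP[-> _] -> _ _].
Qed.

Lemma cycp1 s : size s <= 1 -> cycp s = 1.
Proof.
case: s => [|x [|//]] _; apply/permP=> y; rewrite perm1.
  exact: cycp_notin.
by rewrite cycp_cons_tperm // big_nil perm1.
Qed.

Lemma cycp_fcycle s : uniq s -> fcycle (cycp s) s.
Proof.
move=> us; have := cycle_next us; apply: sub_cycle => x y /eqP <-.
by rewrite /= cycpE.
Qed.

Lemma cycp_consE a X : uniq (a :: X) -> fpath (cycp (a :: X)) a X.
Proof.
move=> us; have := cycle_next us.
rewrite /= rcons_path => /andP[+ _]; apply: sub_path => x y /eqP <-.
by rewrite /= cycpE.
Qed.

Lemma cycp_neq s x : uniq s -> 1 < size s -> (cycp s x != x) = (x \in s).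
Proof.
move=> us s1; apply/idP/idP; first by apply: contraNT => /cycp_notin->.
move=> /rot_to[i p e]; rewrite -(cycp_rot i) // e.
have : uniq (x :: p) by rewrite -e rot_uniq.
have : 1 < size (x :: p) by rewrite -e size_rot.
case: p {e} => // y p _ us'.
have /andP[/eqP /= -> _] := cycp_consE us'.
by move: us'; rewrite /= inE negb_or eq_sym => /andP[/andP[->]].
Qed.

Lemma cycp_cons_traject a X :
  uniq (a :: X) -> a :: X = traject (cycp (a :: X)) a (size X).+1.
Proof.
move=> us; rewrite trajectS; congr cons.
have /fpathP[n e] := cycp_consE us.
by have -> : size X = n by rewrite e size_traject.
Qed.

Lemma cycp_step s1 x y s2 : uniq (s1 ++ x :: y :: s2) ->
  cycp (s1 ++ x :: y :: s2) x = y.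
Proof.
move=> us; rewrite -cycp_catC //.
have : uniq (x :: y :: s2 ++ s1) by rewrite -!cat_cons uniq_catC.
by move/cycp_consE => /andP[/eqP].
Qed.

(** Both words are trajectories of [f] from [a], and distinctness of [a :: Y] keeps [Y] from running
    past the end of the cycle. *)
Lemma cycp_cons_prefix f a X Y : uniq (a :: X) -> f = cycp (a :: X) ->
  uniq (a :: Y) -> fpath f a Y -> exists Z, X = Y ++ Z.
Proof.
move=> uX fE uY pY; exists (drop (size Y) X).
have yX : {subset a :: Y <= a :: X}.
  have [n eY] := fpathP pY => y; rewrite eY -trajectS => /trajectP[i _ ->].
  elim: i => [|i IH] /=; first exact: mem_head.
  by rewrite fE mem_cycp -fE.
have le : size Y <= size X by have := uniq_leq_size uY yX.
rewrite -{1}(cat_take_drop (size Y) X); congr (_ ++ _).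
have [n eY] := fpathP pY.
have := cycp_cons_traject uX; rewrite -fE => -[->].
rewrite take_traject //.
by have -> : size Y = n by rewrite eY size_traject.
Qed.

End Cycles.

(** * Multiplicities of letters in words *)

Lemma uniq_countP (T : eqType) (s : seq T) :
  reflect (forall x, count_mem x s <= 1) (uniq s).
Proof.
apply: (iffP idP) => [us x|]; first by rewrite count_uniq_mem // leq_b1.
elim: s => //= x s IH le1; rewrite IH ?andbT; last first.
  by move=> y; apply: leq_trans (le1 y); rewrite leq_addl.
by rewrite -has_pred1 has_count; have := le1 x; rewrite eqxx; lia.
Qed.

Lemma count_nil T (a : pred T) : count a [::] = 0.
Proof. by []. Qed.

Lemma mem_count (T : eqType) (s : seq T) x : (x \in s) = (0 < count_mem x s).
Proof. by rewrite -has_pred1 has_count. Qed.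

Lemma count_mem_cons (T : eqType) (x y : T) s :
  count_mem x (y :: s) = (y == x) + count_mem x s.
Proof. by []. Qed.

Lemma count_mem_rcons (T : eqType) (x y : T) s :
  count_mem x (rcons s y) = (y == x) + count_mem x s.
Proof. by rewrite -cats1 count_cat /= addn0 addnC. Qed.

Definition count_memE :=
  (count_mem_cons, count_mem_rcons, count_cat, count_rev, count_nil).

(* Duplicate-freeness and membership for concatenations of blocks become linear
   arithmetic on multiplicities. *)
Ltac count_lia x :=
  repeat match goal with
  | H : is_true (uniq ?s) |- _ =>
      move/uniq_countP/(_ x): H; rewrite ?count_memE ?eqxx
  | H : is_true (leq ?m ?n) |- _ =>
      lazymatch constr:((m, n)) with context [@count] => move: H end
  | H : @eq ?A ?m ?n |- _ =>
      unify A nat; lazymatch constr:((m, n)) with context [@count] => move: H end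
  end; rewrite ?count_memE ?eqxx; clear; lia.
Ltac uniq_lia := let x := fresh "x" in apply/uniq_countP => x; count_lia x.

(** * Products of cycles whose words share reversed blocks *)

Section Shapes.

Local Open Scope group_scope.

Variable T : finType.
Implicit Types (s X Y V W U Z : seq T) (a b x y : T) (f g : {perm T}).

Lemma uniq_catN s1 s2 x : uniq (s1 ++ s2) -> x \in s1 -> x \notin s2.
Proof. by rewrite cat_uniq => /and3P[_ /hasPn h _] x1; apply/negP=> /h/negP. Qed.

Lemma cycp_disjointC s1 s2 : uniq (s1 ++ s2) -> commute (cycp s1) (cycp s2).
Proof.
move=> us; apply/permP=> x; rewrite !permM.
have [x1|x1] := boolP (x \in s1).
  by rewrite (cycp_notin (uniq_catN us x1)) cycp_notin // (uniq_catN us) ?mem_cycp.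
rewrite (cycp_notin x1) [RHS]cycp_notin //.
have [x2|x2]  := boolP (x \in s2).
  by rewrite (uniq_catN (s1 := s2)) ?mem_cycp // uniq_catC.
by rewrite cycp_notin.
Qed.

Lemma cycp_cons_rev a V : uniq (a :: V) ->
  cycp (a :: rev V) = (cycp (a :: V))^-1.
Proof.
move=> us; rewrite -rev_rcons cycp_rev; last by uniq_lia.
by rewrite -cats1 -(cycp_catC (s1 := [:: a])).
Qed.

Lemma cycp_mul_overlap V a X W : uniq (V ++ a :: X ++ W) ->
  cycp (V ++ a :: X) * cycp (a :: rev V ++ W) = cycp (a :: X ++ W).
Proof.
move=> us; have -> : cycp (V ++ a :: X) = cycp (a :: X) * cycp (a :: V).
  by rewrite -cycp_catC ?cycp_mul //; uniq_lia.
have -> : cycp (a :: rev V ++ W) = (cycp (a :: V))^-1 * cycp (a :: W).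
  by rewrite -cycp_cons_rev -?cycp_mul //; uniq_lia.
by rewrite !mulgA mulgK cycp_mul //; uniq_lia.
Qed.

(* Both factors are cut at [b], where the blocks [V] cancel; then at [a], where
   the blocks [U] cancel and [tperm a b] occurs twice. *)
Lemma cycp_mul_overlap2 V b Y U a X Z W :
  uniq (V ++ b :: Y ++ U ++ a :: X ++ Z ++ W) ->
  cycp (V ++ b :: Y ++ U ++ a :: X) * cycp (b :: rev V ++ Z ++ a :: rev U ++ W)
  = cycp (a :: X ++ Z) * cycp (b :: Y ++ W).
Proof.
move=> us.
have -> : cycp (V ++ b :: Y ++ U ++ a :: X)
        = cycp (b :: Y) * cycp (U ++ a :: X ++ [:: b]) * cycp (b :: V).
  rewrite -cycp_catC; last by uniq_lia.
  rewrite !cat_cons -cycp_mul; last by uniq_lia.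
  rewrite -(cycp_mul (a := b) (X := Y)); last by uniq_lia.
  by rewrite -(cycp_catC (s1 := [:: b]) (s2 := U ++ a :: X)) -?catA //; uniq_lia.
have -> : cycp (b :: rev V ++ Z ++ a :: rev U ++ W)
        = (cycp (b :: V))^-1 * cycp (a :: rev U ++ W ++ b :: Z).
  rewrite -cycp_cons_rev -1?(cycp_mul (a := b) (X := rev V)); try by uniq_lia.
  congr (_ * _).
  by rewrite -(cycp_catC (s1 := b :: Z) (s2 := a :: rev U ++ W))
    ?cat_cons -?catA //; uniq_lia.
have -> : cycp (b :: Y ++ W) = cycp (b :: Y) * cycp (b :: W).
  by rewrite cycp_mul //; uniq_lia.
have -> : cycp (a :: X ++ Z) = cycp (a :: X) * cycp (a :: Z).
  by rewrite cycp_mul //; uniq_lia.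
have -> : cycp (U ++ a :: X ++ [:: b])
        = cycp (a :: X) * cycp [:: a; b] * cycp (a :: U).
  rewrite -cycp_catC; last by uniq_lia.
  by rewrite cat_cons -cycp_mul ?cycp_mul //; uniq_lia.
have -> : cycp (a :: rev U ++ W ++ b :: Z)
        = (cycp (a :: U))^-1 * (cycp [:: a; b])^-1 * cycp (b :: W) * cycp (a :: Z).
  rewrite -!mulgA -cycp_cons_rev -1?(cycp_mul (X := rev U)); try by uniq_lia.
  congr (_ * _); rewrite -cat_rcons -cycp_mul; last by uniq_lia.
  rewrite mulgA; congr (_ * _); rewrite -cats1 -cat_cons.
  rewrite (cycp_catC (s1 := [:: b]) (s2 := a :: W)); last by uniq_lia.
  rewrite -(cycp_mul (a := b) (X := [:: a])); last by uniq_lia.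
  rewrite -(cycp_cons_rev (V := [:: b])); last by uniq_lia.
  by rewrite (cycp_catC (s1 := [:: b]) (s2 := [:: a])) //; uniq_lia.
(* After the cancellations the product is (b, Y)(a, X)(b, W)(a, Z), to be sorted into (a, X)(a,
   Z)(b, Y)(b, W); only cycles with disjoint supports have to change places. *)
have cYW : commute (cycp (b :: Y)) (cycp (a :: X)).
  by apply: cycp_disjointC; uniq_lia.
have cZ : commute (cycp (a :: Z)) (cycp (b :: Y)).
  by apply: cycp_disjointC; uniq_lia.
have cZW : commute (cycp (a :: Z)) (cycp (b :: W)).
  by apply: cycp_disjointC; uniq_lia.
rewrite !mulgA; do 2!rewrite mulgK; rewrite cYW -!mulgA; congr (_ * _).
by rewrite mulKVg [RHS]mulgA cZ -mulgA cZW.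
Qed.

End Shapes.

(** * Two overlapping cycles *)

Section Overlap.

Local Open Scope group_scope.

Variable T : finType.
Implicit Types (c s X Y V W U Z : seq T) (a b x y : T) (f g : {perm T}).

Lemma sorted_split (P : pred T) s : sorted (fun y z => P y ==> P z) s ->
  exists s1 s2, [/\ s = s1 ++ s2, all (predC P) s1 & all P s2].
Proof.
elim: s => [_|y s IH] /=; first by exists [::], [::].
have [Py ys|NPy] := boolP (P y).
  exists [::], (y :: s); split=> //=; rewrite Py /=.
  by elim: s y Py ys {IH} => //= z s IH y -> /= /andP[Pz /(IH z Pz)->]; rewrite Pz.
move/path_sorted/IH => [s1 [s2 [-> h1 h2]]].
by exists (y :: s1), s2; rewrite /= NPy h1.
Qed.

Lemma fpath_rev f g V a : sorted (frel f) (rcons V a) ->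
  {in V, forall y, g (f y) = y} -> fpath g a (rev V).
Proof.
case: V => //= v V p h.
have := rev_path (fun y z => g y == z) v (rcons V a).
rewrite last_rcons belast_rcons => ->.
elim: V v p h => [|w V IH] v /=.
  by rewrite !andbT => /eqP <- ->; rewrite ?mem_head.
move=> /andP[/eqP vw p] h; rewrite -{1}vw h ?mem_head // eqxx IH //.
by move=> y yV; apply: h; rewrite inE yV orbT.
Qed.

(** If [y] is in [c] and [g] undoes [f] at [y], then [f y] is in [c] too, because [g] preserves [c].
    Membership in [c] thus persists along the path: the overlap is a final block [V], which [g] runs
    through backwards from [a]. *)
Lemma chain_split f g c p a S : fpath f p (rcons S a) ->
  (forall z, (g z \in c) = (z \in c)) ->
  {in S, forall y, y \in c -> g (f y) = y} ->
  exists X V, [/\ S = X ++ V, {in X, forall y, y \notin c}, {subset V <= c}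
    & fpath g a (rev V)].
Proof.
move=> /path_sorted pS gc fg.
have /sorted_split[X [V [eS /allP hX /allP hV]]] :
    sorted (fun y z => (y \in c) ==> (z \in c)) S.
  have : sorted (frel f) S by move: pS; rewrite -cats1 => /cat_sorted2[].
  case: S fg {pS} => //= y S; elim: S y => //= z S IH y fg /andP[/eqP yz p'].
  rewrite IH //; last by move=> t tS; apply: fg; rewrite inE tS orbT.
  by rewrite andbT; apply/implyP=> yc; rewrite -gc -yz fg ?mem_head.
exists X, V; split => //.
apply: (@fpath_rev f); first by move: pS; rewrite eS rcons_cat => /cat_sorted2[].
by move=> y yV; apply: fg; rewrite ?hV // eS mem_cat yV orbT.
Qed.

Lemma cat_prefix s1 b s2 s3 s4 : s1 ++ b :: s2 = s3 ++ s4 -> b \notin s3 ->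
  exists W, s1 = s3 ++ W.
Proof.
elim: s3 s1 => [|x s3 IH] [|y s1] //=; try by eexists.
  by case=> ->; rewrite mem_head.
by case=> -> /IH h; rewrite inE negb_or => /andP[_ /h[W ->]]; exists W.
Qed.

Lemma overlap1 c4 c3 a : uniq c4 -> uniq c3 -> a \in c4 -> a \in c3 ->
  {in c4, forall x, x \in c3 -> x != a -> (cycp c4 * cycp c3) x = x} ->
  exists V X W, [/\ uniq (V ++ a :: X ++ W), cycp c4 = cycp (V ++ a :: X),
    cycp c3 = cycp (a :: rev V ++ W), perm_eq c4 (V ++ a :: X)
    & perm_eq c3 (a :: rev V ++ W)].
Proof.
move=> u4 u3 /rot_to[i S eS] /rot_to[j R eR] fix43.
have uS : uniq (a :: S) by rewrite -eS rot_uniq.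
have uR : uniq (a :: R) by rewrite -eR rot_uniq.
have p4 : perm_eq c4 (a :: S) by rewrite -eS perm_sym perm_rot.
have p3 : perm_eq c3 (a :: R) by rewrite -eR perm_sym perm_rot.
have eq4 : cycp c4 = cycp (a :: S) by rewrite -eS cycp_rot.
have eq3 : cycp c3 = cycp (a :: R) by rewrite -eR cycp_rot.
have pS : fpath (cycp c4) a (rcons S a).
  have := cycle_next u4; rewrite -(rot_cycle i) eS /=.
  by apply: sub_path => x y /eqP<-; rewrite /= cycpE.
have [|X [V [eXV hX hV pV]]] := chain_split pS (mem_cycp c3).
  move=> y yS y3; rewrite -permM fix43 //.
    by rewrite (perm_mem p4) inE yS orbT.
  by apply: contraTneq yS => ->; case/andP: uS.
have uV : uniq (a :: rev V) by move: uS; rewrite eXV => uS; uniq_lia.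
have [W eW] := cycp_cons_prefix uR eq3 uV pV.
exists V, X, W; rewrite eW in p3 uR eq3; rewrite eXV in uS p4 eq4.
have uXW x : x \in X -> x \notin W.
  move=> xX; apply: contra (hX _ xX); rewrite (perm_mem p3) inE mem_cat => ->.
  by rewrite !orbT.
split=> //.
(* Letters of [X] avoid [c3], hence [W]; for any other letter the distinctness of the words of [c4]
   and [c3] is enough. *)
- apply/uniq_countP=> x; case: (boolP (x \in X)) => xX.
    have := uXW x xX; rewrite mem_count -leqNgt leqn0 => /eqP w0.
    by rewrite -!cat_cons !catA count_cat w0; count_lia x.
  move: xX; rewrite mem_count -leqNgt leqn0 => /eqP x0.
  by count_lia x.
- by rewrite eq4 -cycp_catC //; uniq_lia.
by rewrite (perm_trans p4) // -cat_cons perm_catC.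
Qed.

(** The points [b] and [a] cut [c4] into two stretches, and [chain_split] applies to each: the
    overlap with [c3] sits at the end of the stretch, and [c3] leaves [a] along [rev U] and [b]
    along [rev V]. *)
Lemma overlap2 c4 c3 a b : uniq c4 -> uniq c3 -> a != b ->
  a \in c4 -> a \in c3 -> b \in c4 -> b \in c3 ->
  {in c4, forall x, x \in c3 -> x != a -> x != b -> (cycp c4 * cycp c3) x = x} ->
  exists V Y U X Z W,
    let s4 := V ++ b :: Y ++ U ++ a :: X in
    let s3 := b :: rev V ++ Z ++ a :: rev U ++ W in
    [/\ uniq (V ++ b :: Y ++ U ++ a :: X ++ Z ++ W), cycp c4 = cycp s4,
        cycp c3 = cycp s3, perm_eq c4 s4 & perm_eq c3 s3].
Proof.
move=> u4 u3 ab a4 a3 /rot_to[i S eS] /rot_to[j R eR] fix43.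
have uS : uniq (b :: S) by rewrite -eS rot_uniq.
have uR : uniq (b :: R) by rewrite -eR rot_uniq.
have p4 : perm_eq c4 (b :: S) by rewrite -eS perm_sym perm_rot.
have p3 : perm_eq c3 (b :: R) by rewrite -eR perm_sym perm_rot.
have eq4 : cycp c4 = cycp (b :: S) by rewrite -eS cycp_rot.
have eq3 : cycp c3 = cycp (b :: R) by rewrite -eR cycp_rot.
have pS : fpath (cycp c4) b (rcons S b).
  have := cycle_next u4; rewrite -(rot_cycle i) eS /=.
  by apply: sub_path => x y /eqP<-; rewrite /= cycpE.
have aS : a \in S by move: a4; rewrite (perm_mem p4) inE (negbTE ab).
move: pS; case/splitPr: aS eS uS p4 eq4 => S1 S2 _ uS p4 eq4.
rewrite rcons_cat rcons_cons -cat_rcons cat_path last_rcons => /andP[pS1 pS2].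
have fixS y : y \in S1 ++ S2 -> y \in c3 -> cycp c3 (cycp c4 y) = y.
  move=> yS y3; rewrite -permM fix43 //.
  - rewrite (perm_mem p4) inE mem_cat inE.
    by move: yS; rewrite mem_cat => /orP[]->; rewrite !orbT.
  - by apply: contraTneq yS => ->; rewrite mem_count -leqNgt; count_lia a.
  by apply: contraTneq yS => ->; rewrite mem_count -leqNgt; count_lia b.
have [|Y [U [eYU hY hU pU]]] := chain_split pS1 (mem_cycp c3).
  by move=> y yS; apply: fixS; rewrite mem_cat yS.
have [|X [V [eXV hX hV pV]]] := chain_split pS2 (mem_cycp c3).
  by move=> y yS; apply: fixS; rewrite mem_cat yS orbT.
rewrite {S1}eYU {S2}eXV in uS p4 eq4 fixS pS1 pS2.
have [|R1 eR1] := cycp_cons_prefix uR eq3 _ pV; first by uniq_lia.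
(* As [a] is not in [V], it comes after the block [rev V] in the word of [c3]; [Z] is what lies
   between. *)
have aR1 : a \in R1.
  have := a3; rewrite (perm_mem p3) inE (negbTE ab) eR1 mem_cat /= => /orP[aV|//].
  have : uniq (a :: rev V) by uniq_lia.
  by rewrite /= aV.
case/splitPr: aR1 eR1 => Z R2 eR2; rewrite {R eR}eR2 in uR p3 eq3.
have uR' : uniq (a :: R2 ++ b :: rev V ++ Z) by uniq_lia.
have eq3' : cycp c3 = cycp (a :: R2 ++ b :: rev V ++ Z).
  rewrite eq3 catA -cat_cons -(cycp_catC (s1 := b :: rev V ++ Z)) //.
  by uniq_lia.
have [|W0 eW0] := cycp_cons_prefix uR' eq3' _ pU; first by uniq_lia.
(* The block [rev U] starts after [a] and does not contain [b], so it ends before the word of [c3]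
   returns to [b]. *)
have [|W eW] := cat_prefix eW0; first by rewrite mem_count -leqNgt; count_lia b.
rewrite {R2 eW0 uR' eq3'}eW in uR p3 eq3.
exists V, Y, U, X, Z, W => /=; split=> //.
- apply/uniq_countP=> x; case: (boolP (x \in Y ++ X)) => xYX.
    have x3 : x \notin c3 by move: xYX; rewrite mem_cat => /orP[/hY|/hX].
    rewrite (perm_mem p3) mem_count -leqNgt leqn0 in x3.
    by move/eqP: x3; rewrite ?count_memE => x3; count_lia x.
  move: xYX; rewrite mem_count -leqNgt leqn0 ?count_memE => /eqP yx0.
  by count_lia x.
- rewrite eq4 -cycp_catC ?cat_cons -?catA ?cat_cons //; by uniq_lia.
by rewrite (perm_trans p4) // -!cat_cons !catA perm_catC -!catA.
Qed.

End Overlap.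

(** * The two shapes of factorizations *)

Lemma size_cons (T : Type) (x : T) s : size (x :: s) = (size s).+1.
Proof. by []. Qed.

Definition sizeE := (size_cons, size_cat, size_rcons, size_rev).

(* [size] over ['I_d] is elaborated with several convertible presentations of
   the type of elements, which [lia] would take for distinct unknowns. *)
Ltac ord_sizes d := repeat match goal with |- context [@size ?A ?s] =>
  lazymatch A with
  | ordinal d => fail
  | _ => change (@size A s) with (@size 'I_d s)
  end
  end.

Section ShapeDefs.

Local Open Scope group_scope.

Variable T : finType.
Implicit Types (B C X Y V W U Z : seq T) (a b l : T).

(* The points are V, a, X, W, U in this order; a is the end of the overlap of
   the third and fourth cycles and l the point sigma^0(l) of the paper, the
   cycle inverse to (a, X, W) being (l, B, C). *)
Definition shape1 V a X W U l B C : 4.-tuple {perm T} :=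
  [tuple cycp (rev U ++ rcons C l); cycp (U ++ l :: B);
         cycp (a :: rev V ++ W); cycp (V ++ a :: X)].

Definition wf1 V a X W U l B C : Prop :=
  [/\ uniq (V ++ a :: X ++ W ++ U), perm_eq (l :: B ++ C) (a :: X ++ W)
    & cycp (l :: B ++ C) = (cycp (a :: X ++ W))^-1].

(* The points are V, b, Y, U, a, X, Z, W in this order, b being the point k of
   the paper and a its point m. *)
Definition shape2 V b Y U a X Z W : 4.-tuple {perm T} :=
  [tuple cycp (rev (a :: X ++ Z)); cycp (rev (b :: Y ++ W));
         cycp (b :: rev V ++ Z ++ a :: rev U ++ W);
         cycp (V ++ b :: Y ++ U ++ a :: X)].

End ShapeDefs.

(** * The listed cycles as blocks of the word 1, ..., d *)

Section Standard.

Variables (d : nat) (d_gt0 : 0 < d).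

Local Notation pts := (map (pt d_gt0)).

Definition std : seq 'I_d := pts (asc 1 d).

Lemma val_pt i : 0 < i <= d -> val (pt d_gt0 i) = i.-1.
Proof. by move=> h; rewrite val_insubd; case: ifP => //; lia. Qed.

Lemma pt_inj i j : 0 < i <= d -> 0 < j <= d -> pt d_gt0 i = pt d_gt0 j -> i = j.
Proof. by move=> hi hj /(congr1 val); rewrite !val_pt //; lia. Qed.

Lemma size_asc i j : size (asc i j) = j.+1 - i.
Proof. by rewrite size_iota. Qed.

Lemma mem_asc i j x : (x \in asc i j) = (i <= x <= j).
Proof. by rewrite mem_index_iota ltnS. Qed.

Lemma size_std : size std = d.
Proof. by rewrite size_map size_asc subn1. Qed.

Lemma std_uniq : uniq std.
Proof.
rewrite map_inj_in_uniq ?iota_uniq // => i j.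
by rewrite !mem_asc => hi hj; apply: pt_inj; lia.
Qed.

Lemma std_slice L1 M L2 i j : std = L1 ++ M ++ L2 ->
  i = (size L1).+1 -> j = size L1 + size M -> pts (asc i j) = M.
Proof.
have asc_cat n m p : d = n + (m + p) ->
    asc 1 d = iota 1 n ++ asc n.+1 (n + m) ++ iota (n + m).+1 p.
  rewrite /asc /index_iota subn1 /= => ->.
  by rewrite !iotaD; congr (_ ++ (iota _ _ ++ iota _ _)); lia.
move=> e -> ->; have := e; rewrite /std.
rewrite (asc_cat (size L1) (size M) (size L2)); last first.
  by rewrite -!size_cat -e size_std.
rewrite !map_cat => /eqP; rewrite eqseq_cat ?size_map ?size_iota //.
rewrite eqseq_cat ?size_map ?size_asc; first by case/and3P=> _ /eqP.
by rewrite subSS addKn.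
Qed.

Lemma std_slice_rev L1 M L2 i j : std = L1 ++ M ++ L2 ->
  i = (size L1).+1 -> j = size L1 + size M -> pts (desc j i) = rev M.
Proof. by move=> e ei ej; rewrite map_rev (std_slice e ei ej). Qed.

Lemma std_nth L1 x L2 i : std = L1 ++ x :: L2 -> i = (size L1).+1 ->
  pt d_gt0 i = x.
Proof.
move=> e ei; have := @std_slice L1 [:: x] L2 i i e ei.
by rewrite /asc /index_iota subSnn ei /= addn1 => /(_ erefl)[].
Qed.

Section Powers.

Local Open Scope group_scope.

Variables (e3 e4 k l : nat) (aXW : seq 'I_d).
Hypothesis slice : pts (asc k (e3 + e4 - k)) = aXW.

Lemma powersE i j : powers d_gt0 e3 e4 k l i j =
  traject (cycp aXW)^-1%g (((cycp aXW)^-1 ^+ i)%g (pt d_gt0 l)) (j.+1 - i).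
Proof.
rewrite /powers /sigma slice; set f := (cycp aXW)^-1%g.
have -> : [seq (cycp aXW ^- m)%g (pt d_gt0 l) | m <- asc i j]
        = [seq (f ^+ m)%g (pt d_gt0 l) | m <- iota i (j.+1 - i)].
  by apply: eq_map => m; rewrite /f expVgn.
move: (j.+1 - i) => n; elim: n i => //= n IH i; rewrite IH.
congr (_ :: traject _ _ _).
by rewrite expgSr permM.
Qed.

End Powers.

Local Open Scope group_scope.

(** The powers run along the inverse cycle from [l], of length |X| + |W| + 1 =
    [e3 + e4 + 1 - 2 * k]. Exponents 0 to |B| give [l :: B]; those from |B| + 1 to the full length
    give [C] and come back to [l]. The equation on [size B] encodes that the first cycle has length
    [e1]. *)
Lemma factorization1E V a X W U l B C e1 e3 e4 k n :
  std = V ++ a :: X ++ W ++ U -> wf1 V a X W U l B C ->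
  k = (size V).+1 -> e4 = k + size X -> e3 = k + size W ->
  size B + k + e1 = d.+1 -> pt d_gt0 n = l ->
  factorization1 d_gt0 e1 e3 e4 k n = shape1 V a X W U l B C.
Proof.
move=> eS [uS pBC eC] ek e4E e3E szB el.
have sz := perm_size pBC.
have eaXW : pts (asc k (e3 + e4 - k)) = a :: X ++ W.
  apply: (std_slice (L1 := V) (L2 := U)) => //=; rewrite -?catA //.
  by rewrite size_cat; lia.
have := congr1 size eS; rewrite size_std !sizeE => ed.
have szBC : size B + size C = size X + size W.
  by move: sz; rewrite /= !size_cat; lia.
have uC : uniq (l :: B ++ C).
  by rewrite (perm_uniq pBC); uniq_lia.
have [eB eC'] : l :: B = traject (cycp (a :: X ++ W))^-1 l (size B).+1 /\
   rcons C l = traject (cycp (a :: X ++ W))^-1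
     (((cycp (a :: X ++ W))^-1 ^+ (size B).+1) l) (size C).+1.
  have := fcycle_rconsE (cycp_fcycle uC).
  rewrite eC -cat_cons rcons_cat size_cat -addSn -addnS trajectD -permX.
  by move/eqP; rewrite eqseq_cat ?size_traject // => /andP[/eqP-> /eqP->].
rewrite /factorization1 /shape1 !(powersE _ eaXW) el expg0 perm1.
have sU : pts (asc (e3 + e4 + 1 - k) d) = U.
  apply: (std_slice (L1 := V ++ a :: X ++ W) (L2 := [::])).
  - by rewrite eS cats0 -!(catA, cat_cons).
  - by rewrite !sizeE /=; lia.
  by rewrite !sizeE /=; lia.
have sVa : pts (asc 1 k) = rcons V a.
  apply: (std_slice (L1 := [::]) (L2 := X ++ W ++ U)) => //.
    by rewrite eS cat_rcons.
  by rewrite size_rcons.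
have sW : pts (asc (e4 + 1) (e3 + e4 - k)) = W.
  apply: (std_slice (L1 := V ++ a :: X) (L2 := U)).
  - by rewrite eS -!(catA, cat_cons).
  - by rewrite !sizeE /=; lia.
  by rewrite !sizeE /=; lia.
apply: val_inj => /=; congr [:: cycp _; cycp _; cycp _; cycp _].
- rewrite map_rev sU; congr (_ ++ _); rewrite eC'.
  have -> : d + 2 - k - e1 = (size B).+1 by lia.
  by congr (traject _ _ _); lia.
- by rewrite sU eB; have -> : d + 1 - k - e1 = size B by lia.
- by rewrite map_cat map_rev sVa sW rev_rcons.
apply: (std_slice (L1 := [::]) (L2 := W ++ U)) => //.
  by rewrite eS -!(catA, cat_cons).
by rewrite !sizeE /=; lia.
Qed.

(** The equation [m + e1 = (e4 + size Z).+1] says that (a, X, Z) has length [e1]. The last one is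
    inclusion-exclusion: the third and fourth cycles cover all [d] points and share [V], [b], [U],
    [a]. *)
Lemma factorization2E V b Y U a X Z W e1 e3 e4 k m :
  std = V ++ b :: Y ++ U ++ a :: X ++ Z ++ W ->
  k = (size V).+1 -> m = k + size Y + (size U).+1 ->
  e4 = m + size X -> m + e1 = (e4 + size Z).+1 ->
  e3 + e4 = d + k + (size U).+1 ->
  factorization2 d_gt0 e1 e3 e4 k m = shape2 V b Y U a X Z W.
Proof.
move=> eS ek em e4E e1E e34.
have := congr1 size eS; rewrite size_std !sizeE => ed.
rewrite /factorization2 /shape2.
have sW : pts (asc (m + e1) d) = W.
  apply: (std_slice (L1 := V ++ b :: Y ++ U ++ a :: X ++ Z) (L2 := [::])).
  - by rewrite eS cats0 -!(catA, cat_cons).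
  - by rewrite !sizeE /=; lia.
  by rewrite !sizeE /=; lia.
have sZ : pts (asc (e4 + 1) (m + e1 - 1)) = Z.
  apply: (std_slice (L1 := V ++ b :: Y ++ U ++ a :: X) (L2 := W)).
  - by rewrite eS -!(catA, cat_cons).
  - by rewrite !sizeE /=; lia.
  by rewrite !sizeE /=; lia.
have sUa : pts (asc (m + d + 1 + k - e3 - e4) m) = rcons U a.
  apply: (std_slice (L1 := V ++ b :: Y) (L2 := X ++ Z ++ W)).
  - by rewrite eS cat_rcons -!(catA, cat_cons).
  - by rewrite !sizeE /=; lia.
  by rewrite !sizeE /=; lia.
have sbY : pts (asc k (m + d + k - e3 - e4)) = b :: Y.
  apply: (std_slice (L1 := V) (L2 := U ++ a :: X ++ Z ++ W)).
  - by rewrite eS.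
  - by [].
  by rewrite /=; lia.
have sVb : pts (asc 1 k) = rcons V b.
  apply: (std_slice (L1 := [::]) (L2 := Y ++ U ++ a :: X ++ Z ++ W)) => //.
    by rewrite eS cat_rcons.
  by rewrite size_rcons.
apply: val_inj => /=; congr [:: cycp _; cycp _; cycp _; cycp _].
- apply: (std_slice_rev (L1 := V ++ b :: Y ++ U) (L2 := W)).
  + by rewrite eS -!(catA, cat_cons).
  + by rewrite !sizeE /=; lia.
  by rewrite !sizeE /=; lia.
- by rewrite map_cat !map_rev sW sbY -rev_cat.
- by rewrite !map_cat !map_rev sW sUa sVb sZ !rev_rcons.
apply: (std_slice (L1 := [::]) (L2 := Z ++ W)) => //.
  by rewrite eS -!(catA, cat_cons).
by rewrite !sizeE /=; lia.
Qed.

End Standard.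

(** * The Hurwitz conditions for the two shapes *)

Section Facts.

Local Open Scope group_scope.

Lemma tuple4E (A : Type) (t : 4.-tuple A) :
  exists s1 s2 s3 s4, t = [tuple s1; s2; s3; s4].
Proof.
case: t => [[|s1 [|s2 [|s3 [|s4 [|//]]]]] //= i].
by exists s1, s2, s3, s4; apply: val_inj.
Qed.

Lemma sigma34E d (s1 s2 s3 s4 : 'S_d) :
  sigma34 [tuple s1; s2; s3; s4] = s4 * s3.
Proof. by rewrite /sigma34 /permc !(tnth_nth s1) /= !inordK. Qed.

Lemma forall_ord4 (P : pred 'I_4) : [forall i, P i] =
  [&& P (inord 0), P (inord 1), P (inord 2) & P (inord 3)].
Proof.
apply/forallP/and4P => [h|[h0 h1 h2 h3] i]; first by split.
by rewrite -[i]inord_val; case: i => [[|[|[|[|]]]]].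
Qed.

Lemma hurwitz_factorizationE d e1 e2 e3 e4 (s1 s2 s3 s4 : 'S_d) :
  hurwitz_factorization [tuple e1; e2; e3; e4] [tuple s1; s2; s3; s4] =
  [&& [&& is_cycle e1 s1, is_cycle e2 s2, is_cycle e3 s3 & is_cycle e4 s4],
      s4 * s3 * s2 * s1 == 1
    & [transitive <<[set s in [:: s1; s2; s3; s4]]>>, on [set: 'I_d] | 'P]].
Proof.
rewrite /hurwitz_factorization forall_ord4 /permc /= mul1g.
by rewrite !(tnth_nth 0) !(tnth_nth s1) /= !inordK.
Qed.

Lemma hurwitz_equivP d (s1 s2 s3 s4 t1 t2 t3 t4 : 'S_d) :
  reflect (exists g, [/\ t1 = s1 ^ g, t2 = s2 ^ g, t3 = s3 ^ g & t4 = s4 ^ g])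
    (hurwitz_equiv [tuple s1; s2; s3; s4] [tuple t1; t2; t3; t4]).
Proof.
apply: (iffP existsP) => [[g]|[g [-> -> -> ->]]].
  rewrite forall_ord4 !(tnth_nth s1) /= !inordK //=.
  by case/and4P=> /eqP-> /eqP-> /eqP-> /eqP->; exists g.
by exists g; rewrite forall_ord4 !(tnth_nth s1) /= !inordK ?eqxx.
Qed.

Variable T : finType.
Implicit Types (B C X Y V W U Z : seq T) (a b l : T).

Lemma is_cycleP n (s : {perm T}) :
  reflect (exists c, [/\ uniq c, size c = n & s = cycp c]) (is_cycle n s).
Proof.
apply: (iffP existsP) => [[c /andP[uc /eqP ->]]|[c [uc /eqP sc ->]]].
  by exists c; rewrite size_tuple.
by exists (Tuple sc); rewrite uc /=.
Qed.

Lemma orbit_cycp (G : {group {perm T}}) s x y :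
  uniq s -> cycp s \in G -> x \in s -> y \in s -> y \in orbit 'P G x.
Proof.
move=> us sG /rot_to[i p e] ys.
have ue : uniq (x :: p) by rewrite -e rot_uniq.
have : y \in x :: p by rewrite -e mem_rot.
rewrite (cycp_cons_traject ue) => /trajectP[j _ ->]; rewrite -e cycp_rot //.
by rewrite -permX; apply: (mem_orbit 'P); rewrite groupX.
Qed.

Lemma transitive_from (G : {group {perm T}}) a :
  (forall x, x \in orbit 'P G a) -> [transitive G, on [set: T] | 'P].
Proof.
by move=> h; apply/imsetP; exists a => //; apply/setP=> x; rewrite h inE.
Qed.

Lemma wf1_uniq V a X W U l B C : wf1 V a X W U l B C -> uniq (U ++ l :: B ++ C).
Proof.
case=> us p _; have : uniq (U ++ a :: X ++ W) by uniq_lia.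
have := perm_uniq (perm_cat (perm_refl U) p).
by move=> ->.
Qed.

Lemma wf1_uniq_prod V a X W U l B C : wf1 V a X W U l B C -> uniq (a :: X ++ W).
Proof. by case=> us _ _; uniq_lia. Qed.

Lemma shape1_prod34 V a X W U : uniq (V ++ a :: X ++ W ++ U) ->
  cycp (V ++ a :: X) * cycp (a :: rev V ++ W) = cycp (a :: X ++ W).
Proof. by move=> us; apply: cycp_mul_overlap; uniq_lia. Qed.

(** This is the overlap identity again, with [U] as the cancelled block and [l] as the pivot. *)
Lemma shape1_prod12 V a X W U l B C : wf1 V a X W U l B C ->
  cycp (U ++ l :: B) * cycp (rev U ++ rcons C l) = (cycp (a :: X ++ W))^-1.
Proof.
move=> wf; have us := wf1_uniq wf; case: wf => _ _ <-.
rewrite -(cycp_mul_overlap us); congr (_ * _).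
rewrite -cats1 catA -(cycp_catC (s1 := rev U ++ C) (s2 := [:: l])) //.
by uniq_lia.
Qed.

Lemma shape1_cycles V a X W U l B C : wf1 V a X W U l B C ->
  [&& is_cycle (size U + (size C).+1) (cycp (rev U ++ rcons C l)),
      is_cycle (size U + (size B).+1) (cycp (U ++ l :: B)),
      is_cycle (size V + size W).+1 (cycp (a :: rev V ++ W))
    & is_cycle (size V + (size X).+1) (cycp (V ++ a :: X))].
Proof.
move=> wf; have us := wf1_uniq wf; case: wf => uv _ _.
by apply/and4P; split; apply/is_cycleP; eexists; split; try reflexivity;
  rewrite ?sizeE //; uniq_lia.
Qed.

Lemma shape2_cycles V b Y U a X Z W :
  uniq (V ++ b :: Y ++ U ++ a :: X ++ Z ++ W) ->
  [&& is_cycle (size X + size Z).+1 (cycp (rev (a :: X ++ Z))),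
      is_cycle (size Y + size W).+1 (cycp (rev (b :: Y ++ W))),
      is_cycle (size V + (size Z + (size U + size W).+1)).+1
        (cycp (b :: rev V ++ Z ++ a :: rev U ++ W))
    & is_cycle (size V + (size Y + (size U + (size X).+1)).+1)
        (cycp (V ++ b :: Y ++ U ++ a :: X))].
Proof.
by move=> us; apply/and4P; split; apply/is_cycleP; eexists; split;
  try reflexivity; rewrite ?sizeE //; uniq_lia.
Qed.

Lemma shape2_prod V b Y U a X Z W :
  uniq (V ++ b :: Y ++ U ++ a :: X ++ Z ++ W) ->
  cycp (V ++ b :: Y ++ U ++ a :: X) * cycp (b :: rev V ++ Z ++ a :: rev U ++ W)
  * cycp (rev (b :: Y ++ W)) * cycp (rev (a :: X ++ Z)) = 1.
Proof.
move=> us; rewrite cycp_mul_overlap2 // !cycp_rev; try by uniq_lia.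
by rewrite mulgK mulgV.
Qed.

Lemma shape2_uniq34 V b Y U a X Z W :
  uniq (V ++ b :: Y ++ U ++ a :: X ++ Z ++ W) -> uniq ((b :: Y ++ W) ++ a :: X ++ Z).
Proof. by move=> us; uniq_lia. Qed.

Lemma trivial_or_cycle_cycp s : uniq s -> @trivial_or_cycle T (cycp s).
Proof.
move=> us; have [le1|gt1] := leqP (size s) 1; first by left; apply: cycp1.
by right; exists (size s) => //; apply/is_cycleP; exists s.
Qed.

(** The last two cycles join [V], [a], [X], [W]; the second cycle attaches [U] through [l], which
    lies in [a :: X ++ W]. *)
Lemma shape1_transitive V a X W U l B C (s1 : {perm T}) :
  wf1 V a X W U l B C -> (forall x, x \in V ++ a :: X ++ W ++ U) ->
  [transitive <<[set s in [:: s1; cycp (U ++ l :: B);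
      cycp (a :: rev V ++ W); cycp (V ++ a :: X)]]>>, on [set: T] | 'P].
Proof.
move=> wf full; have us := wf1_uniq wf; case: wf => uv p _.
set S := [set s in _]; pose G := <<S>>%G; rewrite -[<<S>>]/(gval G).
have sG s : s \in [:: s1; cycp (U ++ l :: B);
    cycp (a :: rev V ++ W); cycp (V ++ a :: X)] -> s \in G.
  by move=> h; apply: mem_gen; rewrite /S inE.
have o4 x : x \in V ++ a :: X -> x \in orbit 'P G a.
  apply: orbit_cycp; rewrite ?sG ?inE ?eqxx ?orbT //; first by uniq_lia.
  by rewrite mem_cat inE eqxx orbT.
have o3 x : x \in a :: rev V ++ W -> x \in orbit 'P G a.
  by apply: orbit_cycp; rewrite ?sG ?inE ?eqxx ?orbT //; uniq_lia.
have ol : l \in orbit 'P G a.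
  have : l \in a :: X ++ W by rewrite -(perm_mem p) mem_head.
  rewrite inE mem_cat => /or3P[/eqP->|lX|lW]; first by rewrite orbit_refl.
    by apply: o4; rewrite mem_cat inE lX !orbT.
  by apply: o3; rewrite inE mem_cat lW !orbT.
apply: (@transitive_from _ a) => x; have := full x.
rewrite -cat_cons !catA mem_cat => /orP[|xU]; last first.
  apply: orbit_trans _ ol; apply: (@orbit_cycp _ (U ++ l :: B)).
  - by uniq_lia.
  - by rewrite sG ?inE ?eqxx ?orbT.
  - by rewrite mem_cat mem_head orbT.
  by rewrite mem_cat xU.
rewrite mem_cat => /orP[/o4//|xW].
by apply: o3; rewrite inE mem_cat xW !orbT.
Qed.

(** The last two cycles cover all points and have [a] in common. *)
Lemma shape2_transitive V b Y U a X Z W (s1 s2 : {perm T}) :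
  uniq (V ++ b :: Y ++ U ++ a :: X ++ Z ++ W) ->
  (forall x, x \in V ++ b :: Y ++ U ++ a :: X ++ Z ++ W) ->
  [transitive <<[set s in [:: s1; s2;
      cycp (b :: rev V ++ Z ++ a :: rev U ++ W);
      cycp (V ++ b :: Y ++ U ++ a :: X)]]>>, on [set: T] | 'P].
Proof.
move=> us full.
set S := [set s in _]; pose G := <<S>>%G; rewrite -[<<S>>]/(gval G).
have sG s : s \in [:: s1; s2;
      cycp (b :: rev V ++ Z ++ a :: rev U ++ W);
      cycp (V ++ b :: Y ++ U ++ a :: X)] -> s \in G.
  by move=> h; apply: mem_gen; rewrite /S inE.
have o4 x : x \in V ++ b :: Y ++ U ++ a :: X -> x \in orbit 'P G a.
  apply: orbit_cycp; rewrite ?sG ?inE ?eqxx ?orbT //; first by uniq_lia.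
  by rewrite !(mem_cat, inE) eqxx !orbT.
have o3 x : x \in b :: rev V ++ Z ++ a :: rev U ++ W -> x \in orbit 'P G a.
  apply: orbit_cycp; rewrite ?sG ?inE ?eqxx ?orbT //; first by uniq_lia.
  by rewrite !(mem_cat, inE) eqxx !orbT.
apply: (@transitive_from _ a) => x; have := full x.
have [x4 _|x4] := boolP (x \in V ++ b :: Y ++ U ++ a :: X); first exact: o4.
move=> x43; apply: o3; move: x4 x43.
rewrite !(mem_cat, inE).
by do ![case: (x \in _) => //=|case: (x == _) => //=].
Qed.

End Facts.

Lemma size_split (A : Type) n m (s : seq A) : size s = n + m ->
  exists s1 s2, [/\ s = s1 ++ s2, size s1 = n & size s2 = m].
Proof.
move=> e; exists (take n s), (drop n s).
by rewrite cat_take_drop size_drop e addKn size_takel // e leq_addr.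
Qed.

(** * The listed tuples are Hurwitz factorizations *)

Section Listed.

Variables (d e1 e2 e3 e4 : nat) (d_gt0 : 0 < d).
Hypothesis genus0 : 2 * d - 2 = (e1 - 1) + (e2 - 1) + (e3 - 1) + (e4 - 1).
Hypotheses (e1_ge2 : 2 <= e1) (le_e12 : e1 <= e2) (le_e23 : e2 <= e3).
Hypotheses (le_e34 : e3 <= e4) (le_e4d : e4 <= d).

(** The bounds on [k] are nonnegativity of lengths: [e3 + e4 - d <= k] is that of |U|, [k <= e3]
    that of |W|, and [k <= d + 1 - e2] that of |C|, which equals [d + 1 - e2 - k] by the genus
    condition. That [k] is positive comes from [e3 + e4 >= d + 1]. *)
Lemma factorization1_shape k n : admissible1 d e2 e3 e4 k n ->
  exists (V : seq 'I_d) (a : 'I_d) (X W U B C : seq 'I_d),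
  [/\ std d_gt0 = V ++ a :: X ++ W ++ U, wf1 V a X W U (pt d_gt0 n) B C,
      [/\ k = (size V).+1, e4 = k + size X, e3 = k + size W
        & d = size V + (size X + (size W + size U)).+1],
      size B + k + e1 = d.+1 /\ size B + size C = size X + size W
    & factorization1 d_gt0 e1 e3 e4 k n
      = shape1 V a X W U (pt d_gt0 n) B C].
Proof.
case=> hk kd hn.
have [v hv] : exists v, k = v.+1 by exists k.-1; lia.
have [x hx] : exists x, e4 = k + x by exists (e4 - k); lia.
have [w hw] : exists w, e3 = k + w by exists (e3 - k); lia.
have [u hu] : exists u, d = v + (x + (w + u)).+1.
  by exists (d - (e3 + e4 - k)); lia.
have [p hp] : exists p, p + k + e1 = d.+1 by exists (d.+1 - k - e1); lia.
have [q hq] : exists q, p + q = x + w by exists (x + w - p); lia.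
have eL : e3 + e4 - k = k + x + w by lia.
rewrite {}eL in hn *; clear genus0 hk kd le_e12 le_e23 le_e34 le_e4d.
have [|V [s1 [e0 sV]]] := @size_split _ v (x + (w + u)).+1 (std d_gt0).
  by rewrite size_std hu.
case: s1 e0 => [|a s1] //= e0 [s1E].
have [//|X [s2 [e5 sX s2E]]] := @size_split _ x (w + u) s1.
have [//|W [U [e6 sW sU]]] := @size_split _ w u s2.
rewrite e5 e6 in e0.
have us : uniq (V ++ a :: X ++ W ++ U) by rewrite -e0 std_uniq.
have eaXW : map (pt d_gt0) (asc k (k + x + w)) = a :: X ++ W.
  apply: (std_slice (L1 := V) (L2 := U)).
  - by rewrite e0 -!(catA, cat_cons).
  - by rewrite sV.
  by rewrite !sizeE /= sV sX sW; lia.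
have laXW : pt d_gt0 n \in a :: X ++ W.
  by rewrite -eaXW map_f // mem_asc.
(* [B] and [C] are cut from the reversed word of [tau], rotated so as to start at the chosen
   point. *)
have : pt d_gt0 n \in rev (a :: X ++ W) by rewrite mem_rev.
case/rot_to => i BC eBC.
have sBC : (size BC).+1 = size (a :: X ++ W).
  by rewrite -[LHS]/(size (pt d_gt0 n :: BC)) -eBC size_rot size_rev.
rewrite !sizeE /= sX sW -hq in sBC; case: sBC => sBC.
have [|B [C [e7 sB sC]]] := @size_split _ p q BC; first exact: sBC.
have wf : wf1 V a X W U (pt d_gt0 n) B C.
  split=> //; rewrite -e7 -eBC.
    by rewrite perm_rot perm_rev.
  have uaXW : uniq (a :: X ++ W) by uniq_lia.
  by rewrite cycp_rot ?cycp_rev ?rev_uniq.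
exists V, a, X, W, U, B, C; rewrite sV sX sW sB sU sC; split=> //.
by apply: factorization1E; rewrite ?sV ?sX ?sW ?sB.
Qed.

(** The two bounds on [k] give |V| and |U|, the three bounds on [m] give |Z|, |W| and |X|. The
    remaining length |Y| = [m - (e3 + e4 - d)] is nonnegative because the ordering of the [e_i] and
    the genus condition force [e2 + e4 >= d + 1]. *)
Lemma factorization2_shape k m : admissible2 d e1 e3 e4 k m ->
  exists (V : seq 'I_d) (b : 'I_d) (Y U : seq 'I_d) (a : 'I_d) (X Z W : seq 'I_d),
  [/\ std d_gt0 = V ++ b :: Y ++ U ++ a :: X ++ Z ++ W,
      [/\ k = (size V).+1, m = k + size Y + (size U).+1, e4 = m + size X
        & d = size V + (size Y + (size U + (size X + (size Z + size W)).+1)).+1],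
      m + e1 = (e4 + size Z).+1, e3 + e4 = d + k + (size U).+1
    & factorization2 d_gt0 e1 e3 e4 k m = shape2 V b Y U a X Z W].
Proof.
case=> hk hm hme.
have [v hv] : exists v, k = v.+1 by exists k.-1; lia.
have [u hu] : exists u, e3 + e4 = d + k + u.+1.
  by exists (e3 + e4 - d - k).-1; lia.
have [y hy] : exists y, m = k + y + u.+1 by exists (m - k - u.+1); lia.
have [x hx] : exists x, e4 = m + x by exists (e4 - m); lia.
have [z hz] : exists z, m + e1 = (e4 + z).+1 by exists (m + e1 - e4).-1; lia.
have [w hw] : exists w, d = v + (y + (u + (x + (z + w)).+1)).+1.
  by exists (d.+1 - m - e1); lia.
clear genus0 hk hm hme le_e12 le_e23 le_e34 le_e4d.
have [|V [s1 [e0 sV]]] :=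
  @size_split _ v (y + (u + (x + (z + w)).+1)).+1 (std d_gt0).
  by rewrite size_std.
case: s1 e0 => [|b s1] //= e0 [s1E].
have [//|Y [s2 [e5 sY s2E]]] := @size_split _ y (u + (x + (z + w)).+1) s1.
have [//|U [s3 [e6 sU]]] := @size_split _ u (x + (z + w)).+1 s2.
case: s3 e6 => [|a s3] //= e6 [s3E].
have [//|X [s4 [e7 sX s4E]]] := @size_split _ x (z + w) s3.
have [//|Z [W [e8 sZ sW]]] := @size_split _ z w s4.
rewrite e5 e6 e7 e8 in e0.
exists V, b, Y, U, a, X, Z, W; rewrite sV sY sU sX sZ sW; split=> //.
by apply: factorization2E; rewrite ?sV ?sY ?sU ?sX ?sZ.
Qed.

Local Open Scope group_scope.

Lemma full_of_size (T : finType) (s : seq T) : uniq s -> #|T| <= size s ->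
  forall x, x \in s.
Proof.
move=> us le x; have := uniq_min_size us (s2 := enum T).
rewrite -cardE => /(_ _ le)[|_ ->]; last by rewrite mem_enum.
by move=> y; rewrite mem_enum.
Qed.

Lemma mem_std x : x \in std d_gt0.
Proof. by apply: full_of_size; rewrite ?std_uniq // size_std card_ord. Qed.

Lemma factorization1_ok k n : admissible1 d e2 e3 e4 k n ->
  let t := factorization1 d_gt0 e1 e3 e4 k n in
  [/\ hurwitz_factorization [tuple e1; e2; e3; e4] t,
      sigma34 t = sigma d_gt0 e3 e4 k & trivial_or_cycle (sigma34 t)].
Proof.
move=> /factorization1_shape[V [a [X [W [U [B [C
  [eS wf [hk h4 h3 ed] [hB szBC] ->]]]]]]]] t.
have [us p _] := wf; have u12 := wf1_uniq wf.
have s34 : sigma34 t = cycp (a :: X ++ W).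
  by rewrite sigma34E (shape1_prod34 us).
have sg : sigma d_gt0 e3 e4 k = cycp (a :: X ++ W).
  rewrite /sigma (std_slice (L1 := V) (M := a :: X ++ W) (L2 := U)) //.
  - by rewrite eS -!(catA, cat_cons).
  by rewrite !sizeE; lia.
have uaXW := wf1_uniq_prod wf.
split; [|by rewrite s34 sg|by rewrite s34; apply: trivial_or_cycle_cycp].
rewrite hurwitz_factorizationE; apply/and3P; split.
- have -> : e1 = size U + (size C).+1 by lia.
  have -> : e2 = size U + (size B).+1 by lia.
  have -> : e3 = (size V + size W).+1 by lia.
  have -> : e4 = size V + (size X).+1 by lia.
  exact: shape1_cycles wf.
- by rewrite (shape1_prod34 us) -mulgA (shape1_prod12 wf) mulgV.
by apply: (shape1_transitive _ wf) => x; rewrite -eS mem_std.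
Qed.

Lemma factorization2_ok k m : admissible2 d e1 e3 e4 k m ->
  let t := factorization2 d_gt0 e1 e3 e4 k m in
  hurwitz_factorization [tuple e1; e2; e3; e4] t /\
  two_disjoint_cycles (sigma34 t).
Proof.
move=> /factorization2_shape[V [b [Y [U [a [X [Z [W
  [eS [hk hm h4 ed] h1 h3 ->]]]]]]]]] t.
have us : uniq (V ++ b :: Y ++ U ++ a :: X ++ Z ++ W) by rewrite -eS std_uniq.
split.
  rewrite hurwitz_factorizationE; apply/and3P; split.
  - have -> : e1 = (size X + size Z).+1 by lia.
    have -> : e2 = (size Y + size W).+1 by lia.
    have -> : e3 = (size V + (size Z + (size U + size W).+1)).+1 by lia.
    have -> : e4 = size V + (size Y + (size U + (size X).+1)).+1 by lia.
    exact: shape2_cycles us.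
  - by rewrite (shape2_prod us).
  by apply: shape2_transitive => // x; rewrite -eS mem_std.
have gt1Y : 1 < (size Y + size W).+1 by lia.
have gt1X : 1 < (size X + size Z).+1 by lia.
exists (b :: Y ++ W), (a :: X ++ Z); split.
- by rewrite !sizeE.
- by rewrite !sizeE.
- exact: shape2_uniq34 us.
by rewrite sigma34E (cycp_mul_overlap2 us).
Qed.

End Listed.

(** * Points moved by a product of two cycles *)

Section Pair.

Local Open Scope group_scope.

Variable T : finType.
Implicit Types (c s : seq T) (a b x y : T) (f g h : {perm T}).

Definition moved f : {set T} := [set x | f x != x].

Lemma movedV f : moved f^-1 = moved f.
Proof.
by apply/setP=> x; rewrite !inE; congr (~~ _);
   rewrite -(inj_eq (@perm_inj _ f)) permKV eq_sym.
Qed.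

Lemma moved_cycp c : uniq c -> 1 < size c -> moved (cycp c) = [set x in c].
Proof. by move=> uc c1; apply/setP=> x; rewrite !inE cycp_neq. Qed.

Lemma mem_iter_cycp c i a : (iter i (cycp c) a \in c) = (a \in c).
Proof. by elim: i => //= i IH; rewrite mem_cycp. Qed.

Lemma cycp_iter c a x : uniq c -> a \in c -> x \in c ->
  exists i, x = iter i (cycp c) a.
Proof.
move=> uc /rot_to[j p e] xc; have up : uniq (a :: p) by rewrite -e rot_uniq.
have : x \in a :: p by rewrite -e mem_rot.
rewrite (cycp_cons_traject up) => /trajectP[i _ ->].
by exists i; rewrite -e cycp_rot.
Qed.

(** Both cycles traverse the orbit of [a] under [h], so they have the same support and agree
    there. *)
Lemma cycp_eq_on h c s a : uniq c -> uniq s -> a \in c -> a \in s ->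
  {in c, cycp c =1 h} -> {in s, cycp s =1 h} -> cycp c = cycp s.
Proof.
move=> uc us ac as' ch sh.
have itc i : iter i (cycp c) a = iter i h a.
  by elim: i => //= i <-; rewrite ch // mem_iter_cycp.
have its i : iter i (cycp s) a = iter i h a.
  by elim: i => //= i <-; rewrite sh // mem_iter_cycp.
have cs : c =i s.
  move=> x; apply/idP/idP => [/(cycp_iter uc ac)|/(cycp_iter us as')] [i ->].
    by rewrite itc -its mem_iter_cycp.
  by rewrite its -itc mem_iter_cycp.
apply/permP=> x; have [xc|xc] := boolP (x \in c); first by rewrite ch // sh // -cs.
by rewrite !cycp_notin // -cs.
Qed.

Lemma cycp_closed c (K : pred T) a : uniq c -> a \in c -> K a ->
  {in c, forall x, K x -> K (cycp c x)} -> {in c, forall x, K x}.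
Proof.
move=> uc ac Ka cK x /(cycp_iter uc ac)[i ->].
by elim: i => //= i IH; apply: cK; rewrite // mem_iter_cycp.
Qed.

Variables (c c' : seq T).
Hypotheses (uc : uniq c) (uc' : uniq c') (c_gt1 : 1 < size c) (c'_gt1 : 1 < size c').

Let f := cycp c * cycp c'.

Lemma moved_sub : moved f \subset [set x in c] :|: [set x in c'].
Proof.
apply/subsetP=> x; rewrite !inE; apply: contraR; rewrite negb_or => /andP[xc xc'].
by rewrite permM !cycp_notin.
Qed.

(** If [x] lies in [c] only and is fixed by [f], then [cycp c x] and [x] have the same image under
    [cycp c'], so [cycp c] would fix [x]. *)
Lemma fixed_overlap x : (x \in c) || (x \in c') -> f x = x ->
  (x \in c) && (x \in c').
Proof.
rewrite permM; have [xc _|xc] /= := boolP (x \in c); last first.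
  rewrite (cycp_notin xc) => xc' /eqP.
  by rewrite -[_ == _]negbK cycp_neq // xc'.
move=> fx; apply/negPn/negP => xc'.
have : cycp c' (cycp c x) = cycp c' x by rewrite fx cycp_notin.
by move/perm_inj/eqP; rewrite -[_ == _]negbK cycp_neq // xc.
Qed.

(* Otherwise the overlap is stable under both cycles, hence equal to both
   supports, and the cycles are mutually inverse. *)
Lemma overlap_moved a : a \in c -> a \in c' -> f != 1 ->
  exists x, [/\ x \in c, x \in c' & f x != x].
Proof.
move=> ac ac'; have [|/existsPn h] :=
  boolP [exists x, [&& x \in c, x \in c' & f x != x]].
  by case/existsP=> x /and3P[]; exists x.
have fx x : x \in c -> x \in c' -> f x = x.
  by move=> xc xc'; have := h x; rewrite xc xc' /= negbK => /eqP.
have cc' : {in c, forall x, x \in c'}.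
  apply: (cycp_closed (K := mem c') uc ac ac') => x xc /= xc'.
  by rewrite -(mem_cycp c') -permM -/f fx.
have c'c : {in c', forall x, x \in c}.
  apply: (cycp_closed (K := mem c) uc' ac' ac) => x xc' /= xc.
  rewrite -(permKV (cycp c) x); set y := (cycp c)^-1 x.
  have yc : y \in c by rewrite -(mem_cycp c) permKV.
  by rewrite -permM -/f fx // cc'.
case/negP; apply/eqP/permP=> x; rewrite perm1.
have [xc|xc] := boolP (x \in c); first by apply: fx => //; apply: cc'.
by rewrite permM !cycp_notin // ?(contra (c'c x)).
Qed.

Let P := [set x in c] :|: [set x in c'].
Let K := [set x in c] :&: [set x in c'].

(** By [fixed_overlap], the fixed points of [f] in the union all lie in the overlap. Together with
    [card_union_overlap] this gives 2|P| = [size c + size c'] + |moved f| - |K :&: moved f|, the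
    formula that meets the genus condition. *)
Lemma card_union_moved : #|P| + #|K :&: moved f| = #|moved f| + #|K|.
Proof.
have sMP := moved_sub.
have eD : P :\: moved f = K :\: moved f.
  apply/setP=> x; rewrite !inE negbK; case: eqP => //= fx.
  apply/idP/idP => [xP|/andP[-> //]]; exact: fixed_overlap.
have := cardsID (moved f) P; rewrite (setIidPr sMP) eD => <-.
by rewrite -addnA [#|K :\: _| + _]addnC cardsID.
Qed.

Lemma card_union_overlap : #|P| + #|K| = size c + size c'.
Proof. by rewrite cardsUI !cardsE !(card_uniqP _). Qed.

End Pair.

(** * Classification *)

Section Classification.

Local Open Scope group_scope.

Variable T : finType.
Variables (c1 c2 c3 c4 : seq T).
Hypotheses (u1 : uniq c1) (u2 : uniq c2) (u3 : uniq c3) (u4 : uniq c4).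
Hypotheses (gt1 : 1 < size c1) (gt2 : 1 < size c2).
Hypotheses (gt3 : 1 < size c3) (gt4 : 1 < size c4).

Let tau := cycp c4 * cycp c3.

Hypothesis prod : tau * cycp c2 * cycp c1 = 1.
Hypothesis cover :
  forall x, [|| (x \in c4) || (x \in c3) | (x \in c2) || (x \in c1)].
Hypothesis genus : size c1 + size c2 + (size c3 + size c4) = 2 * #|T| + 2.
Hypothesis le_sizes : size c1 + size c2 <= size c3 + size c4.

Let S4 := [set x in c4].
Let S3 := [set x in c3].
Let S2 := [set x in c2].
Let S1 := [set x in c1].

Lemma prod21 : cycp c2 * cycp c1 = tau^-1.
Proof. by apply: (mulgI tau); rewrite mulgA prod mulgV. Qed.

Lemma card_PQ : #|S4 :|: S3| + #|S2 :|: S1| = #|T| + #|(S4 :|: S3) :&: (S2 :|: S1)|.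
Proof.
rewrite -cardsUI; congr (_ + _); rewrite -cardsT; apply: eq_card => x.
by rewrite !inE cover.
Qed.

(** The larger half of the genus sum is at least [#|T| + 1], too much for disjoint supports. *)
Lemma meet34 : exists2 a, a \in c4 & a \in c3.
Proof.
have : 0 < #|S4 :&: S3|.
  have le : #|S4 :|: S3| <= #|T| by rewrite -cardsT subset_leq_card ?subsetT.
  have := card_union_overlap u4 u3; rewrite -/S4 -/S3.
  by move: le genus le_sizes; clear; lia.
by case/card_gt0P=> a; rewrite !inE => /andP[]; exists a.
Qed.

(* Adding the two instances of [card_union_moved], the genus condition leaves
   equality everywhere: one moved point in each overlap, and tau moves all the
   points common to the two unions of supports. *)
Lemma pivots l0 : l0 \in c2 -> l0 \in c1 -> exists a l,
  [/\ [/\ a \in c4, a \in c3, l \in c2 & l \in c1],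
      {in c4, forall x, x \in c3 -> x != a -> (cycp c4 * cycp c3) x = x},
      {in c2, forall x, x \in c1 -> x != l -> (cycp c2 * cycp c1) x = x}
    & (tau != 1 /\ forall x, (x \in c4) || (x \in c3) -> (x \in c2) || (x \in c1) ->
         x \in moved tau)
      \/ [/\ tau = 1, a = l & forall x, (x \in c4) || (x \in c3) ->
           (x \in c2) || (x \in c1) -> x = a]].
Proof.
move=> l02 l01; have [a0 a04 a03] := meet34.
have := card_union_overlap u4 u3; have := card_union_overlap u2 u1.
have := card_union_moved u4 u3 gt4 gt3; have := card_union_moved u2 u1 gt2 gt1.
have m21 : moved (cycp c2 * cycp c1) = moved tau by rewrite prod21 movedV.
rewrite m21 -/tau -/S1 -/S2 -/S3 -/S4; have := card_PQ.
have s21 : moved tau \subset S2 :|: S1 by rewrite -m21; apply: moved_sub.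
have s43 : moved tau \subset S4 :|: S3 by apply: moved_sub.
have sPQ : moved tau \subset (S4 :|: S3) :&: (S2 :|: S1).
  by rewrite subsetI s43 s21.
move=> hPQ hQ hP hK2 hK4.
have [tau1|tau1] := eqVneq tau 1; last first.
  have [x [x4 x3 xm]] := overlap_moved u4 u3 a04 a03 tau1.
  have [y [y2 y1 ym]] :
      exists y, [/\ y \in c2, y \in c1 & (cycp c2 * cycp c1) y != y].
    by apply: overlap_moved l02 l01 _; rewrite // prod21 invg_eq1.
  have xK : x \in S4 :&: S3 :&: moved tau by rewrite !inE x4 x3.
  have yK : y \in S2 :&: S1 :&: moved tau.
    by rewrite -m21 !inE y2 y1.
  have le1 : 0 < #|S4 :&: S3 :&: moved tau| by apply/card_gt0P; exists x.
  have le2 : 0 < #|S2 :&: S1 :&: moved tau| by apply/card_gt0P; exists y.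
  have leS := subset_leq_card sPQ.
  have [e1 e2 eS] : [/\ #|S4 :&: S3 :&: moved tau| = 1%N,
    #|S2 :&: S1 :&: moved tau| = 1%N
    & #|(S4 :|: S3) :&: (S2 :|: S1)| = #|moved tau|].
    move: genus hPQ hP hQ hK2 hK4 le1 le2 leS; clear => *; split; lia.
  exists x, y; split=> //.
  - move=> z z4 z3; apply: contraNeq => zm.
    move/eqP/cards1P: e1 => [w ew]; move: xK; rewrite ew inE => /eqP->.
    have : z \in S4 :&: S3 :&: moved tau by rewrite !inE z4 z3.
    by rewrite ew inE.
  - move=> z z2 z1; apply: contraNeq => zm.
    move/eqP/cards1P: e2 => [w ew]; move: yK; rewrite ew inE => /eqP->.
    have : z \in S2 :&: S1 :&: moved tau by rewrite -m21 !inE z2 z1.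
    by rewrite ew inE.
  left; split=> // z z43 z21.
  have -> : moved tau = (S4 :|: S3) :&: (S2 :|: S1).
    by apply/eqP; rewrite eqEcard sPQ eS leqnn.
  by rewrite !inE z43 z21.
(* Here [tau = 1]: with no moved point the counts make each union equal to its overlap, and the
   genus condition leaves one point common to the two unions. It serves as both pivots. *)
have m0 : moved tau = set0 by apply/setP=> x; rewrite !inE tau1 perm1 eqxx.
rewrite m0 !setI0 !cards0 !addn0 !add0n in hQ hP.
have e1 : #|(S4 :|: S3) :&: (S2 :|: S1)| = 1%N.
  move: genus hPQ hP hQ hK2 hK4; clear; lia.
have eP : S4 :|: S3 = S4 :&: S3.
  by apply/esym/eqP; rewrite eqEcard hP leqnn andbT subIset // subsetUl.
have eQ : S2 :|: S1 = S2 :&: S1.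
  by apply/esym/eqP; rewrite eqEcard hQ leqnn andbT subIset // subsetUl.
move/eqP/cards1P: e1 => [a ea].
have : a \in (S4 :|: S3) :&: (S2 :|: S1) by rewrite ea inE.
rewrite eP eQ !inE => /andP[/andP[a4 a3] /andP[a2 a1]].
exists a, a; split=> //.
- by move=> x _ _ _; rewrite -/tau tau1 perm1.
- by move=> x _ _ _; rewrite prod21 tau1 invg1 perm1.
right; split=> // x x43 x21; apply/set1P; rewrite -ea.
by rewrite !inE x43 x21.
Qed.

(** Applying [overlap1] to both pairs writes [tau] as (a, X, W) and its inverse as (l, B, C). It
    remains to see that the two words have the same letters and that [U] is disjoint from the
    supports of [c3] and [c4]. *)
Lemma classification1 l0 : l0 \in c2 -> l0 \in c1 -> exists V a X W U l B C,
  [/\ wf1 V a X W U l B C, forall x, x \in V ++ a :: X ++ W ++ U,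
      [tuple cycp c1; cycp c2; cycp c3; cycp c4] = shape1 V a X W U l B C
    & [/\ perm_eq c1 (l :: rev U ++ C), perm_eq c2 (U ++ l :: B),
          perm_eq c3 (a :: rev V ++ W) & perm_eq c4 (V ++ a :: X)]].
Proof.
move=> l02 l01.
have [a [l [[a4 a3 l2 l1] fix43 fix21 alt]]] := pivots l02 l01.
have [V [X [W [uVXW e4 e3 p4 p3]]]] := overlap1 u4 u3 a4 a3 fix43.
have [U [B [C [uUBC e2 e1 p2 p1]]]] := overlap1 u2 u1 l2 l1 fix21.
have uaXW : uniq (a :: X ++ W) by clear -uVXW; uniq_lia.
have ulBC : uniq (l :: B ++ C) by clear -uUBC; uniq_lia.
have tauE : tau = cycp (a :: X ++ W) by rewrite /tau e4 e3 cycp_mul_overlap.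
have tauVE : tau^-1 = cycp (l :: B ++ C).
  by rewrite -prod21 e2 e1 cycp_mul_overlap.
have eqPQ x : (x \in c4) || (x \in c3) -> (x \in c2) || (x \in c1) ->
    (x \in a :: X ++ W) && (x \in l :: B ++ C).
  case: alt => [[tau1 h]|[tau1 eal h]] x43 x21; last first.
    by rewrite (h x) // mem_head eal mem_head.
  have := h x x43 x21; have := h x x43 x21; rewrite -{1}movedV !inE => xmV xm.
  apply/andP; split; [move: xm; rewrite tauE|move: xmV; rewrite tauVE];
    by apply: contraNT => xn; rewrite cycp_notin.
have in43 x : (x \in c4) || (x \in c3) = (x \in V) || (x \in a :: X ++ W).
  rewrite (perm_mem p4) (perm_mem p3) !(mem_cat, inE, mem_rev).
  by do ![case: (x \in _) => //=|case: (x == _) => //=].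
have in21 x : (x \in c2) || (x \in c1) = (x \in U) || (x \in l :: B ++ C).
  rewrite (perm_mem p2) (perm_mem p1) !(mem_cat, inE, mem_rev).
  by do ![case: (x \in _) => //=|case: (x == _) => //=].
(* If [tau] moves a point, both words list its support; if not, both shrink to the common pivot. *)
have aXW_lBC x : (x \in a :: X ++ W) = (x \in l :: B ++ C).
  case: alt => [[tau1 _]|[tau1 eal _]].
    have sz1 (s : seq T) : cycp s != 1 -> 1 < size s.
      by apply: contraNT; rewrite -leqNgt => /cycp1->.
    rewrite -(cycp_neq x uaXW) -?(cycp_neq x ulBC) -?tauE -?tauVE
      ?sz1 -?tauE -?tauVE ?invg_eq1 //.
    by have /setP/(_ x) := movedV tau; rewrite !inE => ->.
  have sz1 (b : T) (s : seq T) : uniq (b :: s) -> cycp (b :: s) = 1 -> s = [::].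
    move=> us e; have := @cycp_neq _ (b :: s) b us.
    by rewrite e perm1 eqxx mem_head; case: s {us e} => //= z s /(_ isT).
  rewrite eal (sz1 _ _ uaXW) -?tauE // (sz1 _ _ ulBC) //.
  by rewrite -tauVE tau1 invg1.
(* A point of [U] met by [c4] or [c3] would lie in both unions, hence in [l :: B ++ C], whose
   letters are not in [U]. *)
have UP x : x \in U -> (x \notin V) && (x \notin a :: X ++ W).
  move=> xU; rewrite -negb_or -in43; apply/negP => x43.
  have x21 : (x \in c2) || (x \in c1) by rewrite in21 xU.
  by have /andP[_] := eqPQ x x43 x21; apply/negP; exact: uniq_catN uUBC xU.
exists V, a, X, W, U, l, B, C; split.
- split; last by rewrite -tauE tauVE.
    rewrite -cat_cons !catA cat_uniq -!catA cat_cons uVXW /=.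
    have -> : uniq U by clear -uUBC; uniq_lia.
    rewrite andbT; apply/hasPn => x /UP; rewrite -negb_or.
    by rewrite mem_cat -cat_cons.
  by apply: uniq_perm => // x.
- move=> x; move: (cover x); rewrite in43 in21 -aXW_lBC.
  rewrite !(mem_cat, inE).
  by do ![case: (x \in _) => //=|case: (x == _) => //=].
- rewrite e1 e2 e3 e4; apply: val_inj => /=; congr [:: _; _; _; _].
  by rewrite -cats1 catA -(cycp_catC (s1 := rev U ++ C)) //; clear -uUBC; uniq_lia.
by split.
Qed.

(** * First and second cycles with disjoint supports *)

Section Disjoint.

Hypothesis disj : {in c2, forall x, x \notin c1}.

Lemma disj1 x : x \in c1 -> x \notin c2.
Proof. by move=> x1; apply/negP => /disj; rewrite x1. Qed.

Lemma moved_tau : moved tau = S2 :|: S1.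
Proof.
rewrite -movedV -prod21; apply/eqP; rewrite eqEsubset moved_sub //.
apply/subsetP=> x; rewrite [in X in X -> _]inE !in_set => x21.
apply/eqP => /(fixed_overlap u2 u1 gt2 gt1 x21)/andP[/disj x1 x1'].
by rewrite x1' in x1.
Qed.

Lemma tau_on1 : {in c1, (cycp c1)^-1 =1 tau}.
Proof.
move=> x x1; have -> : tau = (cycp c1)^-1 * (cycp c2)^-1.
  by rewrite -invMg prod21 invgK.
rewrite permM; set y := (cycp c1)^-1 x.
have y1 : y \in c1 by rewrite -(mem_cycp c1) permKV.
by rewrite -[in RHS](cycp_notin (disj1 y1)) permK.
Qed.

Lemma tau_on2 : {in c2, (cycp c2)^-1 =1 tau}.
Proof.
move=> x x2; have -> : tau = (cycp c1)^-1 * (cycp c2)^-1.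
  by rewrite -invMg prod21 invgK.
rewrite permM; congr ((cycp c2)^-1 _).
by rewrite -[x in RHS](cycp_notin (disj x2)) permK.
Qed.

(** Now [tau] moves exactly the points of [c1] and [c2], and it moves only points of [c3] and [c4];
    by [cover], the latter two cover [T]. The number of moved points in their overlap is then the
    sum of the four lengths minus [2 * #|T|], that is 2. *)
Lemma two_pivots : exists a b,
  [/\ a != b, [/\ a \in c4, a \in c3, b \in c4 & b \in c3],
      a \in moved tau, b \in moved tau
    & {in c4, forall x, x \in c3 -> x != a -> x != b ->
        (cycp c4 * cycp c3) x = x}].
Proof.
have hK := card_union_overlap u4 u3; have := card_union_overlap u2 u1.
have := card_union_moved u4 u3 gt4 gt3.
move: hK; rewrite -/tau -/S1 -/S2 -/S3 -/S4 => hK.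
have s43 : moved tau \subset S4 :|: S3 by apply: moved_sub.
have -> : S2 :&: S1 = set0.
  by apply/setP=> x; rewrite !inE; apply/andP=> -[/disj/negP].
have eP : S4 :|: S3 = setT.
  apply/setP=> x; rewrite in_setT; have := cover x.
  case/orP=> [|x21]; first by rewrite !inE.
  by apply: (subsetP s43); rewrite moved_tau !inE.
rewrite cards0 addn0 -moved_tau eP cardsT => hP hM.
rewrite eP cardsT in hK.
have eK2 : #|S4 :&: S3 :&: moved tau| = 2.
  by move: genus hP hM hK; clear; lia.
move/eqP: eK2 => /cards2P[a [b [ab eK]]]; exists a, b.
have inK x : x \in S4 :&: S3 :&: moved tau ->
    [/\ x \in c4, x \in c3 & x \in moved tau].
  by rewrite !in_setI => /andP[/andP[]]; rewrite [x \in S4]inE [x \in S3]inE.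
have [a4 a3 am] : [/\ a \in c4, a \in c3 & a \in moved tau].
  by apply: inK; rewrite eK !inE eqxx.
have [b4 b3 bm] : [/\ b \in c4, b \in c3 & b \in moved tau].
  by apply: inK; rewrite eK !inE eqxx orbT.
split=> // x x4 x3 xa xb.
apply/eqP; apply: contraT => xm.
have : x \in S4 :&: S3 :&: moved tau by rewrite !inE x4 x3.
by rewrite eK !inE (negbTE xa) (negbTE xb).
Qed.

Lemma perm_eq_cycp (c s : seq T) : uniq c -> uniq s -> 1 < size c ->
  cycp c = cycp s -> perm_eq c s.
Proof.
move=> uc us szc e.
have szs : 1 < size s.
  rewrite ltnNge; apply/negP => /cycp1 s1; case: c uc szc e => // x c uc szc e.
  by have := cycp_neq x uc szc; rewrite e s1 perm1 eqxx mem_head.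
by apply: uniq_perm => // x; rewrite -(cycp_neq x uc) // e cycp_neq.
Qed.

Lemma classification2_from a b : a \in c1 -> a != b ->
  a \in c4 -> a \in c3 -> b \in c4 -> b \in c3 ->
  {in c4, forall x, x \in c3 -> x != a -> x != b -> (cycp c4 * cycp c3) x = x} ->
  exists V b Y U a X Z W,
  [/\ uniq (V ++ b :: Y ++ U ++ a :: X ++ Z ++ W),
      forall x, x \in V ++ b :: Y ++ U ++ a :: X ++ Z ++ W,
      [tuple cycp c1; cycp c2; cycp c3; cycp c4] = shape2 V b Y U a X Z W
    & [/\ perm_eq c1 (a :: X ++ Z), perm_eq c2 (b :: Y ++ W),
          perm_eq c3 (b :: rev V ++ Z ++ a :: rev U ++ W)
        & perm_eq c4 (V ++ b :: Y ++ U ++ a :: X)]].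
Proof.
move=> a1 ab a4 a3 b4 b3 fix43.
have [V [Y [U [X [Z [W /= [us e4 e3 p4 p3]]]]]]] :=
  overlap2 u4 u3 ab a4 a3 b4 b3 fix43.
have tauE : tau = cycp (a :: X ++ Z) * cycp (b :: Y ++ W).
  by rewrite /tau e4 e3 cycp_mul_overlap2.
have uaXZ : uniq (a :: X ++ Z) by clear -us; uniq_lia.
have ubYW : uniq (b :: Y ++ W) by clear -us; uniq_lia.
have uu : uniq ((a :: X ++ Z) ++ b :: Y ++ W) by clear -us; uniq_lia.
(* Both the inverse of [c1] and (a, X, Z) follow [tau] and pass through [a]. *)
have e1 : (cycp c1)^-1 = cycp (a :: X ++ Z).
  rewrite -cycp_rev //; apply: (@cycp_eq_on _ tau _ _ a) => //.
  - by rewrite rev_uniq.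
  - by rewrite mem_rev.
  - exact: mem_head.
  - by move=> x; rewrite mem_rev cycp_rev // => /tau_on1.
  move=> x xs; rewrite tauE permM [RHS]cycp_notin //.
  by apply: uniq_catN uu _; rewrite mem_cycp.
have e2 : (cycp c2)^-1 = cycp (b :: Y ++ W).
  apply: (mulgI (cycp (a :: X ++ Z))); rewrite -tauE -e1 -invMg.
  by rewrite prod21 invgK.
have V1 (c s : seq T) : uniq c -> uniq s -> (cycp c)^-1 = cycp s ->
    cycp c = cycp (rev s).
  by move=> uc us' e; rewrite cycp_rev // -e invgK.
exists V, b, Y, U, a, X, Z, W; split=> //.
- move=> x; have := cover x.
  have x21 : (x \in c2) || (x \in c1) -> (x \in b :: Y ++ W) || (x \in a :: X ++ Z).
    move=> x21; have : x \in moved tau by rewrite moved_tau !inE.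
    rewrite inE tauE permM; apply: contraR; rewrite negb_or => /andP[h1 h2].
    by rewrite !cycp_notin.
  move=> /orP[|/x21].
    rewrite (perm_mem p4) (perm_mem p3) !(mem_cat, inE, mem_rev).
    by do ![case: (x \in _) => //=|case: (x == _) => //=].
  rewrite !(mem_cat, inE, mem_rev).
  by do ![case: (x \in _) => //=|case: (x == _) => //=].
- rewrite e3 e4 (V1 _ _ u1 uaXZ e1) (V1 _ _ u2 ubYW e2).
  exact: val_inj.
split=> //.
  rewrite -[X in perm_eq c1 X]revK perm_sym perm_rev perm_sym.
  by apply: perm_eq_cycp; rewrite ?rev_uniq //; apply: V1.
rewrite -[X in perm_eq c2 X]revK perm_sym perm_rev perm_sym.
by apply: perm_eq_cycp; rewrite ?rev_uniq //; apply: V1.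
Qed.

Lemma classification2 : exists V b Y U a X Z W,
  [/\ uniq (V ++ b :: Y ++ U ++ a :: X ++ Z ++ W),
      forall x, x \in V ++ b :: Y ++ U ++ a :: X ++ Z ++ W,
      [tuple cycp c1; cycp c2; cycp c3; cycp c4] = shape2 V b Y U a X Z W
    & [/\ perm_eq c1 (a :: X ++ Z), perm_eq c2 (b :: Y ++ W),
          perm_eq c3 (b :: rev V ++ Z ++ a :: rev U ++ W)
        & perm_eq c4 (V ++ b :: Y ++ U ++ a :: X)]].
Proof.
have [a [b [ab [a4 a3 b4 b3] am bm fix43]]] := two_pivots.
have [a1|a1] := boolP (a \in c1); first exact: (classification2_from a1 ab).
have [b1|b1] := boolP (b \in c1).
  apply: (classification2_from b1 _ b4 b3 a4 a3); first by rewrite eq_sym.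
  by move=> x x4 x3 xb xa; apply: fix43.
(* The remaining case is absurd: with both pivots in [c2], the inverse of [c2] would be (b, Y, W),
   which fixes [a]. *)
have [a2 b2] : a \in c2 /\ b \in c2.
  by move: am bm; rewrite moved_tau !inE (negbTE a1) (negbTE b1) !orbF.
have [V [Y [U [X [Z [W /= [us e4 e3 p4 p3]]]]]]] :=
  overlap2 u4 u3 ab a4 a3 b4 b3 fix43.
have tauE : tau = cycp (a :: X ++ Z) * cycp (b :: Y ++ W).
  by rewrite /tau e4 e3 cycp_mul_overlap2.
have uu : uniq ((a :: X ++ Z) ++ b :: Y ++ W) by clear -us; uniq_lia.
have cE x s : x \in c2 -> uniq s -> x \in s -> {in s, cycp s =1 tau} ->
    (cycp c2)^-1 = cycp s.
  move=> x2 us' xs h; rewrite -cycp_rev //; apply: (@cycp_eq_on _ tau _ _ x) => //.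
  - by rewrite rev_uniq.
  - by rewrite mem_rev.
  by move=> y; rewrite mem_rev cycp_rev // => /tau_on2.
have eb : (cycp c2)^-1 = cycp (b :: Y ++ W).
  apply: (cE b) => //; [by clear -us; uniq_lia|exact: mem_head|].
  move=> x xs; rewrite tauE permM [X in _ = cycp _ X]cycp_notin //.
  by apply: uniq_catN xs; rewrite uniq_catC.
have : a \in moved (cycp c2)^-1 by rewrite movedV inE cycp_neq.
rewrite inE eb cycp_notin ?eqxx //.
by apply: uniq_catN uu _; apply: mem_head.
Qed.

End Disjoint.

End Classification.

(** * Relabelling a shape to a listed tuple *)

Section Relabel.

Local Open Scope group_scope.

Lemma relabel (T : finType) (s r : seq T) : uniq s -> uniq r ->
  size s = size r -> (forall x, x \in s) -> exists g : {perm T}, map g s = r.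
Proof.
move=> us ur sz full.
have inj : injective (fun x => nth x r (index x s)).
  move=> x y; rewrite (set_nth_default y x) -?sz ?index_mem // => /eqP.
  by rewrite nth_uniq -?sz ?index_mem // => /eqP; apply: index_inj.
exists (perm inj); rewrite (eq_map (permE inj)).
case: s us sz {full inj} => [|x0 s] us sz; first by case: r sz {ur}.
apply: (@eq_from_nth _ x0) => [|i]; rewrite size_map // => lt_i.
by rewrite (nth_map x0) // index_uniq // (set_nth_default x0) // -sz.
Qed.

Section Map.

Variables (d : nat) (g : 'S_d).
Implicit Types (B C X Y V W U Z : seq 'I_d) (a b l : 'I_d).

Lemma shape1_equiv V a X W U l B C : hurwitz_equiv (shape1 V a X W U l B C)
  (shape1 (map g V) (g a) (map g X) (map g W) (map g U) (g l) (map g B) (map g C)).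
Proof.
apply/hurwitz_equivP; exists g; rewrite !cycpJ.
by rewrite !(map_cat, map_rev, map_rcons, map_cons).
Qed.

Lemma shape2_equiv V b Y U a X Z W : hurwitz_equiv (shape2 V b Y U a X Z W)
  (shape2 (map g V) (g b) (map g Y) (map g U) (g a) (map g X) (map g Z) (map g W)).
Proof.
apply/hurwitz_equivP; exists g; rewrite !cycpJ.
by rewrite !(map_cat, map_rev, map_cons).
Qed.

Lemma wf1_map V a X W U l B C : wf1 V a X W U l B C ->
  wf1 (map g V) (g a) (map g X) (map g W) (map g U) (g l) (map g B) (map g C).
Proof.
rewrite /wf1 -!(map_cat, map_cons).
case=> u p e; split.
- by rewrite map_inj_uniq //; apply: perm_inj.
- exact: perm_map.
by rewrite -!cycpJ e conjVg.
Qed.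

End Map.

(** A point outside the four supports is fixed by the whole group, hence an orbit by itself. *)
Lemma transitive_cover d (c1 c2 c3 c4 : seq 'I_d) : 1 < d ->
  [transitive <<[set s in [:: cycp c1; cycp c2; cycp c3; cycp c4]]>>,
     on [set: 'I_d] | 'P] ->
  forall x, [|| (x \in c4) || (x \in c3), x \in c2 | x \in c1].
Proof.
move=> d_gt1 tr x; apply: contraT; rewrite !negb_or.
case/andP=> /andP[x4 x3] /andP[x2 x1].
have := atransP tr x (in_setT x) => /(congr1 (fun A : {set _} => #|A|)).
rewrite cardsT card_ord => e.
suff fx : orbit 'P <<[set s in [:: cycp c1; cycp c2; cycp c3; cycp c4]]>> x
    = [set x] by move: e d_gt1; rewrite fx cards1 => <-.
apply/orbit1P; rewrite -sub_astab1 gen_subG; apply/subsetP => s.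
move=> sS; apply/astab1P; move: sS.
by rewrite !inE => /or4P[] /eqP->; rewrite /= /aperm cycp_notin.
Qed.

Section Classify.

Variables (d e1 e2 e3 e4 : nat) (d_gt0 : 0 < d).
Hypothesis genus0 : 2 * d - 2 = (e1 - 1) + (e2 - 1) + (e3 - 1) + (e4 - 1).
Hypotheses (e1_ge2 : 2 <= e1) (le_e12 : e1 <= e2) (le_e23 : e2 <= e3).
Hypotheses (le_e34 : e3 <= e4) (le_e4d : e4 <= d).

Lemma size_full (s : seq 'I_d) : uniq s -> (forall x, x \in s) -> size s = d.
Proof.
move=> us full; rewrite -(card_uniqP us) -[RHS]card_ord.
by apply: eq_card => x; rewrite full.
Qed.

Lemma classify t : hurwitz_factorization [tuple e1; e2; e3; e4] t ->
  (exists k n, admissible1 d e2 e3 e4 k n /\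
     hurwitz_equiv t (factorization1 d_gt0 e1 e3 e4 k n)) \/
  (exists k m, admissible2 d e1 e3 e4 k m /\
     hurwitz_equiv t (factorization2 d_gt0 e1 e3 e4 k m)).
Proof.
have [s1 [s2 [s3 [s4 ->]]]] := tuple4E t; rewrite hurwitz_factorizationE.
case/and3P=> /and4P[/is_cycleP[c1 [u1 z1 ->]] /is_cycleP[c2 [u2 z2 ->]]
  /is_cycleP[c3 [u3 z3 ->]] /is_cycleP[c4 [u4 z4 ->]]] /eqP prod tr.
have d_gt1 : 1 < d by lia.
have cover := transitive_cover d_gt1 tr.
have [gt1 gt2 gt3 gt4] : [/\ 1 < size c1, 1 < size c2, 1 < size c3 & 1 < size c4].
  by split; lia.
have genus : size c1 + size c2 + (size c3 + size c4) = 2 * #|'I_d| + 2.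
  by rewrite card_ord; lia.
have les : size c1 + size c2 <= size c3 + size c4 by lia.
have [/hasP[l0 l02 l01]|/hasPn disj] := boolP (has (mem c1) c2).
  left.
  have [V [a [X [W [U [l [B [C [wf full -> [p1 p2 p3 p4]]]]]]]]]] :=
    classification1 u1 u2 u3 u4 gt1 gt2 gt3 gt4 prod cover genus les l02 l01.
  have [us pBC _] := wf.
  (* [g] carries the concatenated blocks to the word 1, ..., d; the parameter [n] found below is the
     integer naming [g l]. *)
  have [g eg] := relabel us (std_uniq d_gt0)
     (etrans (size_full us full) (esym (size_std d_gt0))) full.
  have : size (V ++ a :: X ++ W ++ U) = d by apply: size_full.
  move: (perm_size p1) (perm_size p2) (perm_size p3) (perm_size p4) (perm_size pBC).
  rewrite z1 z2 z3 z4 !sizeE; ord_sizes d => h1 h2 h3 h4 hBC hd.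
  pose k := (size V).+1.
  have [k4 k3 kB] : [/\ e4 = k + size X, e3 = k + size W & size B + k + e1 = d.+1].
    by rewrite /k; ord_sizes d; move: h1 h2 h3 h4 hd hBC; clear => *; split; lia.
  have eg' : std d_gt0 = map g V ++ g a :: map g X ++ map g W ++ map g U.
    by rewrite -eg !(map_cat, map_cons).
  have eaXW : map (pt d_gt0) (asc k (e3 + e4 - k)) = map g (a :: X ++ W).
    apply: (std_slice (L1 := map g V) (L2 := map g U)).
    - by rewrite eg' map_cons map_cat cat_cons catA.
    - by rewrite size_map.
    by rewrite !size_map !sizeE k3 k4 /k; ord_sizes d; clear; lia.
  have : g l \in map g (a :: X ++ W).
    by rewrite (mem_map perm_inj) -(perm_mem pBC) mem_head.
  rewrite -eaXW => /mapP[n]; rewrite mem_asc => hn egl.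
  have adm : admissible1 d e2 e3 e4 k n.
    rewrite /admissible1; split=> //; move: h1 h2 h3 h4 hd hBC; rewrite /k;
      ord_sizes d; clear => *; lia.
  exists k, n; split=> //.
  rewrite (@factorization1E d d_gt0 (map g V) (g a) (map g X) (map g W) (map g U)
    (g l) (map g B) (map g C)) ?size_map //; first exact: shape1_equiv.
  exact: wf1_map.
right.
have [V [b [Y [U [a [X [Z [W [us full -> [p1 p2 p3 p4]]]]]]]]]] :=
  classification2 u1 u2 u3 u4 gt1 gt2 gt3 gt4 prod cover genus disj.
have [g eg] := relabel us (std_uniq d_gt0)
   (etrans (size_full us full) (esym (size_std d_gt0))) full.
have : size (V ++ b :: Y ++ U ++ a :: X ++ Z ++ W) = d by apply: size_full.
move: (perm_size p1) (perm_size p2) (perm_size p3) (perm_size p4).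
rewrite z1 z2 z3 z4 !sizeE; ord_sizes d => h1 h2 h3 h4 hd.
pose k := (size V).+1; pose m := k + size Y + (size U).+1.
have [adm k4 k1 k3] : [/\ admissible2 d e1 e3 e4 k m, e4 = m + size X,
    m + e1 = (e4 + size Z).+1 & e3 + e4 = d + k + (size U).+1].
  rewrite /admissible2 /m /k; ord_sizes d; move: h1 h2 h3 h4 hd; clear => *.
  by do ![split]; lia.
exists k, m; split=> //.
rewrite (@factorization2E d d_gt0 (map g V) (g b) (map g Y) (map g U) (g a)
  (map g X) (map g Z) (map g W)) ?size_map //; first exact: shape2_equiv.
by rewrite -eg !(map_cat, map_cons).
Qed.

End Classify.

End Relabel.

(** * Distinct parameters *)

Section Rigidity.

Local Open Scope group_scope.

Variable T : finType.
Implicit Types (B C X Y V W U Z s : seq T) (a b l x : T) (f g : {perm T}).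

Lemma mem_movedJ f g x : (g x \in moved (f ^ g)) = (x \in moved f).
Proof. by rewrite !inE permJ (inj_eq perm_inj). Qed.

Lemma movedJ f g : moved (f ^ g) = g @: moved f.
Proof.
apply/setP=> y; rewrite -[y](permKV g) mem_movedJ; apply/idP/imsetP => [h|].
  by exists (g^-1 y).
by case=> x xm /perm_inj->.
Qed.

Lemma iterJ f g x n : f ^ g = f -> iter n f (g x) = g (iter n f x).
Proof. by move=> e; elim: n => //= n ->; rewrite -{1}e permJ. Qed.

Lemma wf1_uniq34 V a X W U l B C : wf1 V a X W U l B C ->
  uniq (V ++ a :: X ++ W).
Proof. by case=> us _ _; uniq_lia. Qed.

(** This recovers [k], which is |V| + 1, from data that conjugation preserves. *)
Lemma shape1_overlap_card V a X W : uniq (V ++ a :: X ++ W) ->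
  1 < size (V ++ a :: X) -> 1 < size (a :: rev V ++ W) ->
  #|moved (cycp (V ++ a :: X)) :&: moved (cycp (a :: rev V ++ W))| = (size V).+1.
Proof.
move=> us gt4 gt3; rewrite !moved_cycp //; try by uniq_lia.
have uaV : uniq (a :: V) by uniq_lia.
rewrite -[RHS](card_uniqP uaV); apply: eq_card => x.
rewrite in_setI !in_set !mem_count; count_lia x.
Qed.

Lemma shape1_pivot V a X W x : uniq (V ++ a :: X ++ W) ->
  x \in V ++ a :: X -> x \in a :: rev V ++ W -> x \in a :: X ++ W -> x = a.
Proof.
move=> us; rewrite !mem_count => h1 h2 h3; apply/eqP; rewrite eq_sym.
rewrite !count_memE in h1 h2 h3; case: eqP h1 h2 h3 => //; count_lia x.
Qed.

(** The conjugator [g] fixes [a], the only point shared by the supports of [s4], [s3] and [tau], and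
    it commutes with [tau]. As [l] is an iterate of [tau] at [a], it is fixed too; but the same
    pivot argument on the other pair sends [l] to [l']. *)
Lemma shape1_rigid V a X W U l B C l' B' C' g :
  wf1 V a X W U l B C -> wf1 V a X W U l' B' C' ->
  1 < size (V ++ a :: X) -> 1 < size (a :: rev V ++ W) -> 1 < size (a :: X ++ W) ->
  1 < size (rev U ++ rcons C l) -> 1 < size (U ++ l :: B) ->
  1 < size (rev U ++ rcons C' l') -> 1 < size (U ++ l' :: B') ->
  cycp (rev U ++ rcons C' l') = cycp (rev U ++ rcons C l) ^ g ->
  cycp (U ++ l' :: B') = cycp (U ++ l :: B) ^ g ->
  cycp (a :: rev V ++ W) = cycp (a :: rev V ++ W) ^ g ->
  cycp (V ++ a :: X) = cycp (V ++ a :: X) ^ g -> l = l'.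
Proof.
move=> wf wf' gt4 gt3 gt34 gt1 gt2 gt1' gt2' e1 e2 e3 e4.
have u12 := wf1_uniq wf; have u12' := wf1_uniq wf'.
have [us pBC _] := wf; have [_ pBC' _] := wf'.
have tE := shape1_prod34 us; have uaXW := wf1_uniq_prod wf.
have e34 : cycp (a :: X ++ W) ^ g = cycp (a :: X ++ W).
  by rewrite -tE conjMg -e4 -e3.
have mem f s x : uniq s -> 1 < size s -> f = cycp s -> (x \in moved f) = (x \in s).
  by move=> us' gt -> ; rewrite moved_cycp // inE.
have um4 : uniq (V ++ a :: X) by uniq_lia.
have um3 : uniq (a :: rev V ++ W) by uniq_lia.
have um1 : uniq (rev U ++ rcons C l) by uniq_lia.
have um2 : uniq (U ++ l :: B) by uniq_lia.
have um1' : uniq (rev U ++ rcons C' l') by uniq_lia.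
have um2' : uniq (U ++ l' :: B') by uniq_lia.
have ga : g a = a.
  apply: (@shape1_pivot V a X W); first by uniq_lia.
  - rewrite -(mem _ _ _ um4 gt4 erefl) e4 mem_movedJ moved_cycp //.
    by rewrite inE mem_cat mem_head orbT.
  - by rewrite -(mem _ _ _ um3 gt3 erefl) e3 mem_movedJ moved_cycp // inE mem_head.
  by rewrite -(mem _ _ _ uaXW gt34 erefl) -e34 mem_movedJ moved_cycp // inE mem_head.
have laXW : l \in a :: X ++ W by rewrite -(perm_mem pBC) mem_head.
have gl : g l = l'.
  have h1 : g l \in U ++ l' :: B'.
    rewrite -(mem _ _ _ um2' gt2' erefl) e2 mem_movedJ moved_cycp //.
    by rewrite inE mem_cat mem_head orbT.
  have h2 : g l \in rev U ++ rcons C' l'.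
    rewrite -(mem _ _ _ um1' gt1' erefl) e1 mem_movedJ moved_cycp //.
    by rewrite inE mem_cat mem_rcons mem_head orbT.
  have h3 : g l \in l' :: B' ++ C'.
    rewrite (perm_mem pBC') -(mem _ _ _ uaXW gt34 erefl) -e34 mem_movedJ.
    by rewrite moved_cycp // inE.
  apply: (@shape1_pivot U l' B' C') => //.
  move: h2; rewrite !(mem_cat, mem_rcons, inE, mem_rev).
  by case: (_ == _) => //=; rewrite ?orbT.
have [n en] := cycp_iter uaXW (mem_head a _) laXW.
by rewrite -gl en -iterJ // ga.
Qed.

Lemma mem_cycpJ s s' g x : uniq s -> uniq s' -> 1 < size s -> 1 < size s' ->
  cycp s' = cycp s ^ g -> x \in s -> g x \in s'.
Proof.
move=> us us' gt gt' e xs; have : g x \in moved (cycp s').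
  by rewrite e mem_movedJ moved_cycp // inE.
by rewrite moved_cycp // inE.
Qed.

Lemma shape2_pivots V b Y U a X Z W x :
  uniq (V ++ b :: Y ++ U ++ a :: X ++ Z ++ W) ->
  x \in V ++ b :: Y ++ U ++ a :: X -> x \in b :: rev V ++ Z ++ a :: rev U ++ W ->
  (x \in rev (a :: X ++ Z) -> x = a) /\ (x \in rev (b :: Y ++ W) -> x = b).
Proof.
move=> us; rewrite !mem_rev !mem_count !count_memE => h1 h2.
split=> h3; apply/eqP; rewrite eq_sym.
  by case: (a =P x) h1 h2 h3 => //; count_lia x.
by case: (b =P x) h1 h2 h3 => //; count_lia x.
Qed.

Lemma shape2_rigid V b Y U a X Z W V' b' Y' U' a' X' Z' W' g :
  uniq (V ++ b :: Y ++ U ++ a :: X ++ Z ++ W) ->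
  uniq (V' ++ b' :: Y' ++ U' ++ a' :: X' ++ Z' ++ W') ->
  0 < size X + size Z -> 0 < size Y + size W ->
  0 < size X' + size Z' -> 0 < size Y' + size W' ->
  cycp (rev (a' :: X' ++ Z')) = cycp (rev (a :: X ++ Z)) ^ g ->
  cycp (rev (b' :: Y' ++ W')) = cycp (rev (b :: Y ++ W)) ^ g ->
  cycp (b' :: rev V' ++ Z' ++ a' :: rev U' ++ W')
    = cycp (b :: rev V ++ Z ++ a :: rev U ++ W) ^ g ->
  cycp (V' ++ b' :: Y' ++ U' ++ a' :: X')
    = cycp (V ++ b :: Y ++ U ++ a :: X) ^ g ->
  [/\ g a = a', g b = b' & {in a :: X, forall x, g x \in a' :: X' ++ Z'}].
Proof.
move=> us us' gt1 gt2 gt1' gt2' e1 e2 e3 e4.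
have in1 x : x \in rev (a :: X ++ Z) -> g x \in rev (a' :: X' ++ Z').
  by apply: mem_cycpJ e1; rewrite ?sizeE ?ltnS //; uniq_lia.
have in2 x : x \in rev (b :: Y ++ W) -> g x \in rev (b' :: Y' ++ W').
  by apply: mem_cycpJ e2; rewrite ?sizeE ?ltnS //; uniq_lia.
have in3 x : x \in b :: rev V ++ Z ++ a :: rev U ++ W ->
    g x \in b' :: rev V' ++ Z' ++ a' :: rev U' ++ W'.
  by apply: mem_cycpJ e3; rewrite ?sizeE ?ltnS ?addnS //; uniq_lia.
have in4 x : x \in V ++ b :: Y ++ U ++ a :: X ->
    g x \in V' ++ b' :: Y' ++ U' ++ a' :: X'.
  by apply: mem_cycpJ e4; rewrite ?sizeE ?addnS ?ltnS //; uniq_lia.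
split.
- apply: (proj1 (shape2_pivots us' (in4 a _) (in3 a _)) (in1 a _));
    by rewrite ?mem_rev !(mem_cat, inE) eqxx ?orbT.
- apply: (proj2 (shape2_pivots us' (in4 b _) (in3 b _)) (in2 b _));
    by rewrite ?mem_rev !(mem_cat, inE) eqxx ?orbT.
move=> x xs; rewrite -mem_rev; apply: in1.
by rewrite mem_rev -cat_cons mem_cat xs.
Qed.

(** In the first shape [l] lies in the supports of both [s1] and [s2]; in the second these supports
    are disjoint. *)
Lemma shapes_not_equiv V a X W U l B C V' b' Y' U' a' X' Z' W' g :
  wf1 V a X W U l B C ->
  uniq (V' ++ b' :: Y' ++ U' ++ a' :: X' ++ Z' ++ W') ->
  0 < size U + size C -> 0 < size U + size B ->
  0 < size X' + size Z' -> 0 < size Y' + size W' ->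
  cycp (rev (a' :: X' ++ Z')) = cycp (rev U ++ rcons C l) ^ g ->
  cycp (rev (b' :: Y' ++ W')) = cycp (U ++ l :: B) ^ g -> False.
Proof.
move=> wf us' gt1 gt2 gt1' gt2' e1 e2; have us := wf1_uniq wf.
have h1 : g l \in rev (a' :: X' ++ Z').
  apply: mem_cycpJ e1 _; rewrite ?sizeE ?addnS ?ltnS //; try by uniq_lia.
  by rewrite mem_cat mem_rcons mem_head orbT.
have h2 : g l \in rev (b' :: Y' ++ W').
  apply: mem_cycpJ e2 _; rewrite ?sizeE ?addnS ?ltnS //; try by uniq_lia.
  by rewrite mem_cat mem_head orbT.
by move: h1 h2; rewrite !mem_rev !mem_count; count_lia (g l).
Qed.

End Rigidity.

Section Distinct.

Local Open Scope group_scope.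

Lemma hurwitz_equiv_refl d (t : 4.-tuple 'S_d) : hurwitz_equiv t t.
Proof. by apply/existsP; exists 1; apply/forallP=> i; rewrite conjg1. Qed.

Lemma hurwitz_equiv_sym d (t u : 4.-tuple 'S_d) :
  hurwitz_equiv t u -> hurwitz_equiv u t.
Proof.
case/existsP=> g /forallP h; apply/existsP; exists g^-1; apply/forallP=> i.
by rewrite (eqP (h i)) conjgK.
Qed.

Lemma hurwitz_equiv_trans d (t u v : 4.-tuple 'S_d) :
  hurwitz_equiv t u -> hurwitz_equiv u v -> hurwitz_equiv t v.
Proof.
case/existsP=> g /forallP h /existsP[g' /forallP h']; apply/existsP.
exists (g * g'); apply/forallP=> i.
by rewrite (eqP (h' i)) (eqP (h i)) conjgM.
Qed.

Variables (d e1 e2 e3 e4 : nat) (d_gt0 : 0 < d).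
Hypothesis genus0 : (2 * d - 2 = (e1 - 1) + (e2 - 1) + (e3 - 1) + (e4 - 1))%N.
Hypotheses (e1_ge2 : 2 <= e1) (le_e12 : e1 <= e2) (le_e23 : e2 <= e3).
Hypotheses (le_e34 : e3 <= e4) (le_e4d : e4 <= d).

Local Notation pts := (map (pt d_gt0)).
Local Notation fact1_shape := (factorization1_shape d_gt0
  genus0 e1_ge2 le_e12 le_e23 le_e34 le_e4d).
Local Notation fact2_shape := (factorization2_shape d_gt0
  genus0 e1_ge2 le_e12 le_e23 le_e34 le_e4d).

Lemma factorization1_inj k n k' n' :
  admissible1 d e2 e3 e4 k n -> admissible1 d e2 e3 e4 k' n' ->
  hurwitz_equiv (factorization1 d_gt0 e1 e3 e4 k n)
    (factorization1 d_gt0 e1 e3 e4 k' n') -> k = k' /\ n = n'.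
Proof.
move=> adm adm'.
have [V [a [X [W [U [B [C [eS wf [hk h4 h3 hd] [hB hBC] ->]]]]]]]] :=
  fact1_shape adm.
have [V' [a' [X' [W' [U' [B' [C' [eS' wf' [hk' h4' h3' hd'] [hB' hBC'] ->]]]]]]]] :=
  fact1_shape adm'.
case: adm adm' => [_ _ hn] [_ _ hn'].
have gts : [/\ 1 < (size V + (size X).+1)%N, 1 < (size V + size W).+1,
    1 < (size U + (size C).+1)%N & 1 < (size U + (size B).+1)%N].
  by move: genus0 le_e12 le_e23 le_e34 e1_ge2 h4 h3 hk hd hB hBC; clear;
    ord_sizes d => *; split; lia.
have gts' : [/\ 1 < (size V' + (size X').+1)%N, 1 < (size V' + size W').+1,
    1 < (size U' + (size C').+1)%N & 1 < (size U' + (size B').+1)%N].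
  by move: genus0 le_e12 le_e23 le_e34 e1_ge2 h4' h3' hk' hd' hB' hBC'; clear;
    ord_sizes d => *; split; lia.
case/hurwitz_equivP=> g [g1 g2 g3 g4].
have ekk : k = k'.
  case: gts gts' => gt4 gt3 gt1 gt2 [gt4' gt3' gt1' gt2'].
  rewrite hk hk' -(shape1_overlap_card (wf1_uniq34 wf)) ?sizeE //.
  rewrite -(shape1_overlap_card (wf1_uniq34 wf')) ?sizeE //.
  rewrite g4 g3 !movedJ -imsetI ?card_imset //; first exact: perm_inj.
  by move=> ? ? _ _; apply: perm_inj.
split=> //; rewrite -{}ekk in hk' h4' h3' hn' hB'.
move: eS'; rewrite eS => /eqP; have sV : size V = size V'.
  by move: hk hk'; ord_sizes d; lia.
rewrite eqseq_cat // eqseq_cons eqseq_cat; last by move: h4 h4'; ord_sizes d; lia.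
rewrite eqseq_cat; last by move: h3 h3'; ord_sizes d; lia.
case/and5P=> /eqP eV /eqP ea /eqP eX /eqP eW /eqP eU; subst V' a' X' W' U'.
(* When [tau] is trivial its word has one letter, and the range of [n] is the single integer [k]. *)
have [s1|gt34] := leqP (size (a :: X ++ W)) 1.
  by move: s1 hn hn'; rewrite h3 h4 /= size_cat; ord_sizes d; clear; lia.
have epn : pt d_gt0 n = pt d_gt0 n'.
  case: gts gts' => gt4 gt3 gt1 gt2 [_ _ gt1' gt2'].
  by apply: (shape1_rigid wf wf' _ _ gt34 _ _ _ _ g1 g2 g3 g4); rewrite ?sizeE.
by apply: pt_inj epn; move: hn hn' hk h3 h4 hd; ord_sizes d; clear; lia.
Qed.

Lemma iter_asc m i n : m <= d -> 0 < i -> i + n <= m ->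
  iter n (cycp (pts (asc 1 m))) (pt d_gt0 i) = pt d_gt0 (i + n).
Proof.
move=> md i0; elim: n => [|n IH] le; first by rewrite addn0.
rewrite iterS IH; last by lia.
have us : uniq (pts (asc 1 m)).
  rewrite map_inj_in_uniq ?iota_uniq // => x y.
  by rewrite !mem_asc => hx hy; apply: pt_inj; lia.
have e : asc 1 m = asc 1 (i + n).-1 ++ [:: (i + n)%N, (i + n).+1 & asc (i + n).+2 m].
  rewrite /asc /index_iota.
  have -> : (m.+1 - 1 = (i + n).-1 + (m - (i + n).+1).+2)%N by lia.
  rewrite iotaD /=; have -> : (1 + (i + n).-1 = i + n)%N by lia.
  by congr (iota _ _ ++ [:: _, _ & iota _ _]); lia.
by rewrite addnS; move: us; rewrite e map_cat /=; apply: cycp_step.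
Qed.

Lemma cycp_asc_last m : 1 < m <= d ->
  cycp (pts (asc 1 m)) (pt d_gt0 m) = pt d_gt0 1.
Proof.
move=> md; have us : uniq (pts (asc 1 m)).
  rewrite map_inj_in_uniq ?iota_uniq // => x y.
  by rewrite !mem_asc => hx hy; apply: pt_inj; lia.
have e : asc 1 m = (1 :: asc 2 m.-1)%N ++ [:: m].
  rewrite /asc /index_iota subn1 /= prednK; last by lia.
  rewrite -{1}(@prednK m) /=; last by lia.
  have -> : m.-1 = (m - 2 + 1)%N by lia.
  by rewrite iotaD /=; congr (_ :: _ ++ [:: _]); lia.
rewrite e map_cat /= in us *.
rewrite -(cycp_catC (s1 := _ :: _) (s2 := [:: _])) //.
have us2 : uniq ([:: pt d_gt0 m] ++ (pt d_gt0 1 :: pts (asc 2 m.-1))).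
  by rewrite uniq_catC.
exact: (@cycp_step _ [::] _ _ _ us2).
Qed.

(** A conjugator sends [b] to [b'] and [a] to [a'] and commutes with the common fourth cycle, so
    positions along it can be compared. Only inequalities are proved; exchanging the two tuples
    turns them into equalities. *)
Lemma factorization2_asym k m k' m' :
  admissible2 d e1 e3 e4 k m -> admissible2 d e1 e3 e4 k' m' ->
  hurwitz_equiv (factorization2 d_gt0 e1 e3 e4 k m)
    (factorization2 d_gt0 e1 e3 e4 k' m') ->
  m' + k <= m + k' /\ k' <= k.
Proof.
move=> adm adm'.
pose s4 : 'S_d := cycp (pts (asc 1 e4)).
have [V [b [Y [U [a [X [Z [W [eS [hk hm h4 hd] he1 he3 ->]]]]]]]]] :=
  fact2_shape adm.
have [V' [b' [Y' [U' [a' [X' [Z' [W' [eS' [hk' hm' h4' hd'] he1' he3' ->]]]]]]]]] :=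
  fact2_shape adm'.
have us : uniq (V ++ b :: Y ++ U ++ a :: X ++ Z ++ W) by rewrite -eS std_uniq.
have us' : uniq (V' ++ b' :: Y' ++ U' ++ a' :: X' ++ Z' ++ W').
  by rewrite -eS' std_uniq.
have [sX sY] : 0 < size X + size Z /\ 0 < size Y + size W.
  by move: genus0 le_e12 e1_ge2 hk hm h4 hd he1 he3; clear;
    ord_sizes d => *; split; lia.
have [sX' sY'] : 0 < size X' + size Z' /\ 0 < size Y' + size W'.
  by move: genus0 le_e12 e1_ge2 hk' hm' h4' hd' he1' he3'; clear;
    ord_sizes d => *; split; lia.
case/hurwitz_equivP=> g [g1 g2 g3 g4].
have [ga gb gX] := shape2_rigid us us' sX sY sX' sY' g1 g2 g3 g4.
have c4 : cycp (V ++ b :: Y ++ U ++ a :: X) = s4.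
  congr cycp; apply/esym; apply: (std_slice (L1 := [::]) (L2 := Z ++ W)) => //.
    by rewrite eS -!(catA, cat_cons).
  by move: hk hm h4; rewrite !sizeE; ord_sizes d; clear => /=; lia.
have c4' : cycp (V' ++ b' :: Y' ++ U' ++ a' :: X') = s4.
  congr cycp; apply/esym; apply: (std_slice (L1 := [::]) (L2 := Z' ++ W')) => //.
    by rewrite eS' -!(catA, cat_cons).
  by move: hk' hm' h4'; rewrite !sizeE; ord_sizes d; clear => /=; lia.
have it x i : iter i s4 (g x) = g (iter i s4 x).
  by apply: iterJ; rewrite -c4 -g4 c4 c4'.
have eb : pt d_gt0 k = b by apply: std_nth eS _.
have eb' : pt d_gt0 k' = b' by apply: std_nth eS' _.
have ea : pt d_gt0 m = a.
  apply: (@std_nth _ _ (V ++ b :: Y ++ U) _ (X ++ Z ++ W)).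
    by rewrite eS -!(catA, cat_cons).
  by move: hk hm; rewrite !sizeE; ord_sizes d; clear; lia.
have ea' : pt d_gt0 m' = a'.
  apply: (@std_nth _ _ (V' ++ b' :: Y' ++ U') _ (X' ++ Z' ++ W')).
    by rewrite eS' -!(catA, cat_cons).
  by move: hk' hm'; rewrite !sizeE; ord_sizes d; clear; lia.
have km : k < m by move: hk hm; ord_sizes d; clear; lia.
have km' : k' < m' by move: hk' hm'; ord_sizes d; clear; lia.
have [k0 k0'] : 0 < k /\ 0 < k' by rewrite hk hk'.
have [m4 m4'] : m <= e4 /\ m' <= e4.
  by split; [rewrite h4|rewrite h4']; rewrite leq_addr.
split; rewrite leqNgt; apply/negP => lt.
  (* From [b'], [m - k] steps of [s4] reach [k' + (m - k)], which is below [m'], hence at most [e4],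
     so nothing wraps around; yet they must also reach [a'], the point [m']. *)
  have := it b (m - k)%N; rewrite gb -eb -eb' /s4 !iter_asc //; try lia.
  rewrite (_ : k + (m - k) = m)%N; last by lia.
  rewrite ea ga -ea' => e.
  by have := pt_inj _ _ e; lia.
(* If [k < k'], going back [k] steps from [b] and from [b'] shows that [g] sends [e4] to [k' - k].
   But [e4] belongs to [a :: X], so its image must lie between [m'] and [m' + e1 - 1], beyond
   [k']. *)
have l4 : iter k s4 (pt d_gt0 e4) = b.
  rewrite -eb -[k in LHS]prednK // iterSr /s4 cycp_asc_last; last by lia.
  by rewrite iter_asc // add1n prednK //; lia.
have e : pt d_gt0 (k' - k) = g (pt d_gt0 e4).
  suff : iter k s4 (pt d_gt0 (k' - k)) = iter k s4 (g (pt d_gt0 e4)).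
    by rewrite -!permX => /perm_inj.
  by rewrite it l4 gb -eb' /s4 iter_asc ?subnK //; lia.
have : g (pt d_gt0 e4) \in a' :: X' ++ Z'.
  apply: gX; have -> : a :: X = pts (asc m e4).
    apply/esym; apply: (std_slice (L1 := V ++ b :: Y ++ U) (L2 := Z ++ W)).
    - by rewrite eS -!(catA, cat_cons).
    - by move: hk hm; rewrite !sizeE; ord_sizes d; clear; lia.
    by move: hk hm h4; rewrite !sizeE; ord_sizes d; clear; lia.
  by rewrite map_f // mem_asc; lia.
have -> : a' :: X' ++ Z' = pts (asc m' (m' + e1).-1).
  apply/esym; apply: (std_slice (L1 := V' ++ b' :: Y' ++ U') (L2 := W')).
  - by rewrite eS' -!(catA, cat_cons).
  - by move: hk' hm'; rewrite !sizeE; ord_sizes d; clear; lia.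
  by move: hk' hm' h4' he1'; rewrite !sizeE; ord_sizes d; clear; lia.
rewrite -e => /mapP[j]; rewrite mem_asc => hj ej.
have hmd : m' + e1 <= d.+1 by move: he1' hd' h4' hm' hk'; ord_sizes d; clear; lia.
by have := pt_inj _ _ ej; lia.
Qed.

Lemma factorization_inj i j :
  admissible d e1 e2 e3 e4 i -> admissible d e1 e2 e3 e4 j ->
  hurwitz_equiv (factorization d_gt0 e1 e3 e4 i) (factorization d_gt0 e1 e3 e4 j) ->
  i = j.
Proof.
have not12 k n k' m' : admissible1 d e2 e3 e4 k n -> admissible2 d e1 e3 e4 k' m' ->
    hurwitz_equiv (factorization1 d_gt0 e1 e3 e4 k n)
      (factorization2 d_gt0 e1 e3 e4 k' m') -> False.
  move=> adm adm'.
  have [V [a [X [W [U [B [C [eS wf [hk h4 h3 hd] [hB hBC] ->]]]]]]]] :=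
  fact1_shape adm.
  have [V' [b' [Y' [U' [a' [X' [Z' [W' [eS' [hk' hm' h4' hd'] he1' he3' ->]]]]]]]]] :=
    fact2_shape adm'.
  have us' : uniq (V' ++ b' :: Y' ++ U' ++ a' :: X' ++ Z' ++ W').
    by rewrite -eS' std_uniq.
  case/hurwitz_equivP=> g [g1 g2 _ _].
  apply: (shapes_not_equiv wf us' _ _ _ _ g1 g2).
  - by move: genus0 le_e12 e1_ge2 h4 h3 hk hd hB hBC; clear; ord_sizes d; lia.
  - by move: genus0 le_e12 e1_ge2 h4 h3 hk hd hB hBC; clear; ord_sizes d; lia.
  - by move: genus0 le_e12 e1_ge2 hk' hm' h4' hd' he1' he3'; clear; ord_sizes d; lia.
  by move: genus0 le_e12 e1_ge2 hk' hm' h4' hd' he1' he3'; clear; ord_sizes d; lia.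
case: i j => [k n|k m] [k' n'|k' m'] /= ai aj eij.
- by have [-> ->] := factorization1_inj ai aj eij.
- by case: (not12 _ _ _ _ ai aj eij).
- by case: (not12 _ _ _ _ aj ai (hurwitz_equiv_sym eij)).
have [h1 h2] := factorization2_asym ai aj eij.
have [h3 h4] := factorization2_asym aj ai (hurwitz_equiv_sym eij).
by congr Second; lia.
Qed.

End Distinct.

(** * Counting *)

(** Sum of an arithmetic progression with difference -2, starting at [c], stated without
    subtraction. *)
Lemma sumn_arith (c lo n : nat) (f : nat -> nat) :
  (forall i, i < n -> f (lo + i) + 2 * i = c) ->
  sumn [seq f k | k <- iota lo n] + n * n = n * c + n.
Proof.
elim: n => [//|n IH] h.
have -> : iota lo n.+1 = iota lo n ++ [:: lo + n] by rewrite -addn1 iotaD.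
rewrite map_cat sumn_cat /= addn0.
have := IH (fun i lt => h i (ltnW lt)); have := h n (leqnn _); nia.
Qed.

(* The function a |-> a (s - a) is concave and symmetric about s / 2. *)
Lemma leq_mul_sub a b s : a <= b -> a + b <= s -> a * (s - a) <= b * (s - b).
Proof.
move=> /subnKC + /subnKC; move: (b - a) (s - (a + b)) => x y <- <-.
have -> : a + (a + x) + y - a = a + x + y by lia.
have -> : a + (a + x) + y - (a + x) = a + y by lia.
nia.
Qed.

(** Comparing [e1 + e4] with [d + 1] decides every minimum. If [e1 + e4 <= d + 1], type (i)
    contributes [e1 * e2] and type (ii) [e1 * (d + 1 - e1 - e2)]. Otherwise, with [r = d + 1 - e4],
    the contributions are [r * (d + 1 - e3)] and [r * (e3 + e4 - d - 1)], with total [r * e4]. *)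
Lemma sum_indices d e1 e2 e3 e4 :
  2 * d - 2 = (e1 - 1) + (e2 - 1) + (e3 - 1) + (e4 - 1) ->
  2 <= e1 -> e1 <= e2 -> e2 <= e3 -> e3 <= e4 -> e4 <= d ->
  sumn [seq (e3 + e4 - k).+1 - k |
          k <- iota (e3 + e4 - d) ((minn e3 (d + 1 - e2)).+1 - (e3 + e4 - d))] +
  ((e3 + e4 - d - 1).+1 - 1) * ((minn e4 (d + 1 - e1)).+1 - (e4 - e1 + 1)) =
  minn (minn (e1 * (d + 1 - e1)) (e2 * (d + 1 - e2)))
       (minn (e3 * (d + 1 - e3)) (e4 * (d + 1 - e4))).
Proof.
move=> genus e1_ge2 le12 le23 le34 led.
have [le14|gt14] := leqP (e1 + e4) (d + 1).
  have -> : (minn e3 (d + 1 - e2)).+1 - (e3 + e4 - d) = e1 by lia.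
  have -> : (minn e4 (d + 1 - e1)).+1 - (e4 - e1 + 1) = e1 by lia.
  have eS : sumn [seq (e3 + e4 - k).+1 - k | k <- iota (e3 + e4 - d) e1]
      + e1 * e1 = e1 * (e1 + (e2 - 1)) + e1.
    by apply: sumn_arith => i lt; lia.
  have h2 : e1 * (d + 1 - e1) <= e2 * (d + 1 - e2) by apply: leq_mul_sub; lia.
  have h3 : e1 * (d + 1 - e1) <= e3 * (d + 1 - e3) by apply: leq_mul_sub; lia.
  have h4 : e1 * (d + 1 - e1) <= e4 * (d + 1 - e4) by apply: leq_mul_sub; lia.
  rewrite (minn_idPl h2) (minn_idPl _); last by rewrite leq_min h3 h4.
  clear h2 h3 h4.
  have [t et] : exists t, d + 1 - e1 = e2 - 1 + 1 + t.
    by exists (d + 1 - e1 - e2); lia.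
  have -> : (e3 + e4 - d - 1).+1 - 1 = t by lia.
  by rewrite et; move: (e2 - 1) (sumn _) eS; clear; nia.
have [r er] : exists r, d + 1 = e4 + r by exists (d + 1 - e4); lia.
have -> : (minn e3 (d + 1 - e2)).+1 - (e3 + e4 - d) = r by lia.
have -> : (minn e4 (d + 1 - e1)).+1 - (e4 - e1 + 1) = r by lia.
have eS : sumn [seq (e3 + e4 - k).+1 - k | k <- iota (e3 + e4 - d) r]
    + r * r = r * (r + (d - e3)) + r.
  by apply: sumn_arith => i lt; lia.
have f4 : e4 * (d + 1 - e4) = r * (d + 1 - r) by rewrite mulnC; congr (_ * _); lia.
have h1 : r * (d + 1 - r) <= e1 * (d + 1 - e1) by apply: leq_mul_sub; lia.
have h2 : r * (d + 1 - r) <= e2 * (d + 1 - e2) by apply: leq_mul_sub; lia.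
have h3 : r * (d + 1 - r) <= e3 * (d + 1 - e3) by apply: leq_mul_sub; lia.
rewrite f4 [minn (e3 * _) _](minn_idPr h3) (minn_idPr _); last first.
  by rewrite leq_min h1 h2.
clear h1 h2 h3 f4.
have [t et] : exists t, d + 1 - r = d - e3 + 1 + t.
  by exists (e3 + e4 - d - 1); lia.
have -> : (e3 + e4 - d - 1).+1 - 1 = t by lia.
by rewrite et; move: (d - e3) (sumn _) eS; clear; nia.
Qed.

Section Count.

Variables (d e1 e2 e3 e4 : nat).

Definition indices1 : seq (nat * nat) :=
  [seq (k, n) | k <- asc (e3 + e4 - d) (minn e3 (d + 1 - e2)),
                n <- asc k (e3 + e4 - k)].
Definition indices2 : seq (nat * nat) :=
  [seq (k, m) | k <- asc 1 (e3 + e4 - d - 1),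
                m <- asc (e4 - e1 + 1) (minn e4 (d + 1 - e1))].

Lemma mem_indices1 k n :
  reflect (admissible1 d e2 e3 e4 k n) ((k, n) \in indices1).
Proof.
apply: (iffP allpairsPdep) => [[x [y]]|[h1 h2 h3]].
  by rewrite !mem_asc => -[h1 h2 [-> ->]]; split=> //; lia.
by exists k, n; rewrite !mem_asc; split=> //; lia.
Qed.

Lemma mem_indices2 k m :
  reflect (admissible2 d e1 e3 e4 k m) ((k, m) \in indices2).
Proof.
apply: (iffP allpairsPdep) => [[x [y]]|[h1 h2 h3]].
  by rewrite !mem_asc => -[h1 h2 [-> ->]]; split=> //; lia.
by exists k, m; rewrite !mem_asc; split=> //; lia.
Qed.

Lemma uniq_indices : uniq indices1 && uniq indices2.
Proof.
apply/andP; split; (apply: allpairs_uniq_dep; 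
  [exact: iota_uniq|by move=> x _; apply: iota_uniq|]);
  by move=> [x y] [x' y'] _ _ /= [-> ->].
Qed.

Lemma size_indices :
  2 * d - 2 = (e1 - 1) + (e2 - 1) + (e3 - 1) + (e4 - 1) ->
  2 <= e1 -> e1 <= e2 -> e2 <= e3 -> e3 <= e4 -> e4 <= d ->
  size indices1 + size indices2 =
  minn (minn (e1 * (d + 1 - e1)) (e2 * (d + 1 - e2)))
       (minn (e3 * (d + 1 - e3)) (e4 * (d + 1 - e4))).
Proof.
rewrite !size_allpairs_dep /asc /index_iota.
under [X in _ + sumn X]eq_map do rewrite size_iota.
under [X in sumn X + _]eq_map do rewrite size_iota.
have -> r c : sumn [seq c | _ <- r] = size r * c.
  by elim: r => //= _ r ->.
rewrite size_iota; exact: sum_indices.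
Qed.

End Count.

(** A single cycle moving [x] and [y] makes [y] an iterate of [x], while the iterates of [x] stay in
    the first of two disjoint cycles. *)
Lemma not_trivial_and_disjoint (T : finType) (s : {perm T}) :
  trivial_or_cycle s -> ~ two_disjoint_cycles s.
Proof.
move=> triv [c1 [c2 [gt1 gt2 us es]]].
case: c1 c2 gt1 gt2 us es => [//|x c1] [//|y c2] gt1 gt2 us es.
have [u1 u2] : uniq (x :: c1) /\ uniq (y :: c2).
  by move: us; rewrite cat_uniq => /and3P[-> _ ->].
have s1 : {in x :: c1, s =1 cycp (x :: c1)}.
  by move=> z z1; rewrite es permM (cycp_notin (uniq_catN us z1)).
have s2 : {in y :: c2, s =1 cycp (y :: c2)}.
  move=> z z2; rewrite es permM cycp_notin //.
  apply: (uniq_catN (s1 := y :: c2)); last by rewrite mem_cycp.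
  by rewrite uniq_catC.
have xs : s x != x by rewrite s1 ?mem_head // cycp_neq ?mem_head.
have ys : s y != y by rewrite s2 ?mem_head // cycp_neq ?mem_head.
case: triv => [e|[n n1 /is_cycleP[c [uc sc ec]]]].
  by move: xs; rewrite e perm1 eqxx.
have xc : x \in c by rewrite -(cycp_neq x uc) ?sc // -ec.
have yc : y \in c by rewrite -(cycp_neq y uc) ?sc // -ec.
have [i yi] := cycp_iter uc xc yc.
have : y \in x :: c1.
  rewrite yi -ec; elim: i {yi} => [|i IH]; first exact: mem_head.
  by rewrite iterS s1 // mem_cycp.
by move=> y1; have := uniq_catN us y1; rewrite mem_head.
Qed.

Section Number.

Variables (d e1 e2 e3 e4 : nat) (d_gt0 : 0 < d).
Hypothesis genus0 : 2 * d - 2 = (e1 - 1) + (e2 - 1) + (e3 - 1) + (e4 - 1).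
Hypotheses (e1_ge2 : 2 <= e1) (le_e12 : e1 <= e2) (le_e23 : e2 <= e3).
Hypotheses (le_e34 : e3 <= e4) (le_e4d : e4 <= d).

Let e := [tuple e1; e2; e3; e4].
Let adm := admissible d e1 e2 e3 e4.
Let fact := factorization d_gt0 e1 e3 e4.

Lemma factorization_ok i : adm i -> hurwitz_factorization e (fact i).
Proof.
case: i => [k n|k m] /= h.
  by have [] := factorization1_ok d_gt0 genus0 e1_ge2 le_e12 le_e23 le_e34 le_e4d h.
by have [] := factorization2_ok d_gt0 genus0 e1_ge2 le_e12 le_e23 le_e34 le_e4d h.
Qed.

Lemma fact_inj i j : adm i -> adm j -> fact i = fact j -> i = j.
Proof.
move=> ai aj eij.
apply: (factorization_inj genus0 e1_ge2 le_e12 le_e23 le_e34 le_e4d ai aj).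
by rewrite -/(fact _) eij; apply: hurwitz_equiv_refl.
Qed.

Lemma classify_entry t : hurwitz_factorization e t ->
  exists2 i, adm i & hurwitz_equiv t (fact i).
Proof.
case/(classify d_gt0 genus0 e1_ge2 le_e12 le_e23 le_e34 le_e4d).
  by case=> k [n [a et]]; exists (First k n).
by case=> k [m [a et]]; exists (Second k m).
Qed.

Let reps := [seq fact (First p.1 p.2) | p <- indices1 d e2 e3 e4]
  ++ [seq fact (Second p.1 p.2) | p <- indices2 d e1 e3 e4].

Lemma mem_reps t : t \in reps <-> exists2 i, adm i & t = fact i.
Proof.
rewrite mem_cat; split.
  case/orP=> /mapP[[k l] kl ->].
    by exists (First k l) => //; apply/mem_indices1.
  by exists (Second k l) => //; apply/mem_indices2.
case=> -[k l|k l] a ->; apply/orP; [left|right]; apply/mapP; exists (k, l) => //.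
  exact/mem_indices1.
exact/mem_indices2.
Qed.

Lemma uniq_reps : uniq reps.
Proof.
have [u1 u2] := andP (uniq_indices d e1 e2 e3 e4).
rewrite cat_uniq !map_inj_in_uniq ?u1 ?u2 ?andbT /=; last 2 first.
- move=> [k m] [k' m'] /mem_indices2 a /mem_indices2 a' h.
  by have [-> ->] := fact_inj (i := Second _ _) (j := Second _ _) a a' h.
- move=> [k n] [k' n'] /mem_indices1 a /mem_indices1 a' h.
  by have [-> ->] := fact_inj (i := First _ _) (j := First _ _) a a' h.
apply/hasPn => t /mapP[[k m] /mem_indices2 a ->].
apply/mapP => -[[k' n'] /mem_indices1 a' h].
by have := fact_inj (i := Second _ _) (j := First _ _) a a' h.
Qed.

(** Taking the class is a bijection from [reps] to the partition: injective by [factorization_inj],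
    surjective by [classify_entry]. *)
Lemma hurwitz_numberE : hurwitz_number d e =
  minn (minn (e1 * (d + 1 - e1)) (e2 * (d + 1 - e2)))
       (minn (e3 * (d + 1 - e3)) (e4 * (d + 1 - e4))).
Proof.
rewrite -(size_indices genus0) //.
have -> : size (indices1 d e2 e3 e4) + size (indices2 d e1 e3 e4) = size reps.
  by rewrite size_cat !size_map.
rewrite -(card_uniqP uniq_reps) /hurwitz_number /equivalence_partition.
set D := [set t | _]; pose cls t := [set u in D | hurwitz_equiv t u].
have repsD t : t \in reps -> t \in D.
  by case/mem_reps=> i a ->; rewrite inE factorization_ok.
rewrite -(card_in_imset (f := cls) (D := mem reps)); last first.
  move=> t u tr ur ecls; have /mem_reps[i ai ei] := tr.
  have /mem_reps[j aj ej] := ur.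
  have : u \in cls t by rewrite ecls inE repsD // hurwitz_equiv_refl.
  rewrite inE => /andP[_]; rewrite ei ej => h.
  by rewrite (factorization_inj genus0 e1_ge2 le_e12 le_e23 le_e34 le_e4d ai aj h).
apply: eq_card => A; apply/imsetP/imsetP => -[t tD ->]; last first.
  by exists t; rewrite ?repsD.
have [i ai ti] : exists2 i, adm i & hurwitz_equiv t (fact i).
  by apply: classify_entry; rewrite inE in tD.
exists (fact i); first by apply/mem_reps; exists i.
apply/setP=> u; rewrite !inE; congr (_ && _); apply/idP/idP => h.
  exact: hurwitz_equiv_trans (hurwitz_equiv_sym ti) h.
exact: hurwitz_equiv_trans ti h.
Qed.

End Number.

Lemma conj_two_disjoint (T : finType) (s g : {perm T}) :
  two_disjoint_cycles s -> two_disjoint_cycles (s ^ g)%g.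
Proof.
case=> c1 [c2 [h1 h2 us ->]]; exists (map g c1), (map g c2).
rewrite !size_map -map_cat map_inj_uniq; last exact: perm_inj.
by rewrite /permc conjMg !cycpJ.
Qed.

Lemma conj_trivial_or_cycle (T : finType) (s g : {perm T}) :
  trivial_or_cycle s -> trivial_or_cycle (s ^ g)%g.
Proof.
case=> [->|[n n1 /is_cycleP[c [uc sc ->]]]]; first by left; rewrite conj1g.
right; exists n => //; apply/is_cycleP; exists (map g c).
by rewrite map_inj_uniq ?size_map ?cycpJ //; apply: perm_inj.
Qed.

Lemma sigma34J d (t u : 4.-tuple 'S_d) : hurwitz_equiv t u ->
  exists g, sigma34 u = (sigma34 t ^ g)%g.
Proof.
case/existsP=> g /forallP h; exists g.
by rewrite /sigma34 /permc !(eqP (h _)) conjMg.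
Qed.

Theorem theorem4p2 (d e1 e2 e3 e4 : nat) (d_gt0 : 0 < d)
    (genus0 : 2 * d - 2 = (e1 - 1) + (e2 - 1) + (e3 - 1) + (e4 - 1))
    (e1_ge2 : 2 <= e1) (le_e12 : e1 <= e2) (le_e23 : e2 <= e3)
    (le_e34 : e3 <= e4) (le_e4d : e4 <= d) :
  let e := [tuple e1; e2; e3; e4] in
  [/\ hurwitz_number d e =
        minn (minn (e1 * (d + 1 - e1)) (e2 * (d + 1 - e2)))
             (minn (e3 * (d + 1 - e3)) (e4 * (d + 1 - e4))),
      forall k l, admissible1 d e2 e3 e4 k l ->
        let t := factorization1 d_gt0 e1 e3 e4 k l in
        [/\ hurwitz_factorization e t,
            sigma34 t = sigma d_gt0 e3 e4 k & trivial_or_cycle (sigma34 t)],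
      forall k m, admissible2 d e1 e3 e4 k m ->
        let t := factorization2 d_gt0 e1 e3 e4 k m in
        hurwitz_factorization e t /\ two_disjoint_cycles (sigma34 t)
    & forall t : 4.-tuple 'S_d, hurwitz_factorization e t ->
        [/\ trivial_or_cycle (sigma34 t) ->
              exists k l, admissible1 d e2 e3 e4 k l /\
                hurwitz_equiv t (factorization1 d_gt0 e1 e3 e4 k l),
            two_disjoint_cycles (sigma34 t) ->
              exists k m, admissible2 d e1 e3 e4 k m /\
                hurwitz_equiv t (factorization2 d_gt0 e1 e3 e4 k m)
          & exists! i : entry, admissible d e1 e2 e3 e4 i /\
              hurwitz_equiv t (factorization d_gt0 e1 e3 e4 i)]].
Proof.
move=> e; split.
- exact: hurwitz_numberE.
- by move=> k l; apply: factorization1_ok.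
- by move=> k m; apply: factorization2_ok.
move=> t ht; split.
(* The classification chooses the type by the supports of the first two cycles; the wrong type is
   excluded here because [sigma34] is carried along by conjugation. *)
- move=> triv; have [//|[k [m [a et]]]] :=
    classify d_gt0 genus0 e1_ge2 le_e12 le_e23 le_e34 le_e4d ht.
  have [g eg] := sigma34J et.
  have [_ two] :=
    factorization2_ok d_gt0 genus0 e1_ge2 le_e12 le_e23 le_e34 le_e4d a.
  by case: (not_trivial_and_disjoint (conj_trivial_or_cycle g triv)); rewrite -eg.
- move=> two; have [[k [n [a et]]]|//] :=
    classify d_gt0 genus0 e1_ge2 le_e12 le_e23 le_e34 le_e4d ht.
  have [g eg] := sigma34J et.
  have [_ _ triv] :=
    factorization1_ok d_gt0 genus0 e1_ge2 le_e12 le_e23 le_e34 le_e4d a.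
  by case: (not_trivial_and_disjoint triv); rewrite eg; apply: conj_two_disjoint.
have [i ai ti] := classify_entry d_gt0 genus0 e1_ge2 le_e12 le_e23 le_e34 le_e4d ht.
exists i; split=> // j [aj tj].
apply: (factorization_inj genus0 e1_ge2 le_e12 le_e23 le_e34 le_e4d ai aj).
exact: hurwitz_equiv_trans (hurwitz_equiv_sym ti) tj.
Qed.
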